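(* The asymptotically optimal $m$ for estimating $F$ with respect to MISE is $$m_{opt}=n^{2/3}\left[\frac{4C_3^S}{C_2^S}\right]^{2/3},$$ which leads, as $n\to\infty$, to the optimal MISE $$\operatorname{MISE}\left[\hat F^S_{m_{opt},n}\right]=n^{-1}C_1^S-\frac34n^{-4/3}\left[\frac{(C_2^S)^4}{4C_3^S}\right]^{1/3}+o(n^{-4/3}).$$ Here $$C_1^S=\int_0^\infty\sigma^2(x)e^{-ax}f(x)\,dx,\quad C_2^S=\int_0^\infty V^S(x)e^{-ax}f(x)\,dx,\quad C_3^S=\int_0^\infty (b^S(x))^2e^{-ax}f(x)\,dx,$$ with $\sigma^2(x)=F(x)(1-F(x))$, $V^S(x)=f(x)\left[\frac{x}{\pi}\right]^{1/2}$ and $b^S(x)=\frac{xf'(x)}{2}$.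
   Context: Let $X_1,X_2,\dots$ be i.i.d. random variables with values in $[0,\infty)$, with distribution function $F$ ($F(0)=0$) and density $f$. Standing assumption: $F$ is continuous, and the first and second derivatives $f=F'$ and $f'=F''$ of $F$ exist and are continuous and bounded on $[0,\infty)$. The empirical distribution function is $F_n(x)=\frac1n\sum_{i=1}^n \mathbb{I}(X_i\le x)$. For $m>0$, $k\in\{0,1,2,\dots\}$ and $x\ge 0$ let $V_{k,m}(x)=e^{-mx}\frac{(mx)^k}{k!}$ (with $0^0=1$). The Szasz estimator is $\hat F^S_{m,n}(x)=\sum_{k=0}^\infty F_n\left(\frac km\right)V_{k,m}(x)$. Fix a constant $a\in(0,\infty)$. The (weighted) mean-integrated squared error is $\operatorname{MISE}[\hat F^S_{m,n}]=\mathbb{E}\left[\int_0^\infty\left(\hat F^S_{m,n}(x)-F(x)\right)^2e^{-ax}f(x)\,dx\right]$. ''Asymptotically optimal with respect to MISE'' means: minimizing over $m>0$ the leading part $n^{-1}C_1^S-m^{-1/2}n^{-1}C_2^S+m^{-2}C_3^S$ of the asymptotic expansion $\operatorname{MISE}[\hat F^S_{m,n}]=n^{-1}C_1^S-m^{-1/2}n^{-1}C_2^S+m^{-2}C_3^S+o(m^{-1/2}n^{-1})+o(m^{-2})$ as $m,n\to\infty$. Since $m_{opt}$ need not be an integer, the formula defining the estimator is used with a real parameter $m>0$. The notation $u=o(v)$ means $\lim|u/v|=0$. *)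

(* Defs.v *)
From HB Require Export structures.
From mathcomp Require Export all_boot all_order all_algebra.
From mathcomp Require Export all_classical all_reals all_analysis.
Export Order.TTheory GRing.Theory Num.Theory.
Export numFieldNormedType.Exports.

Set Implicit Arguments.
Unset Strict Implicit.
Unset Printing Implicit Defensive.

Local Open Scope classical_set_scope.
Local Open Scope ring_scope.

Definition mutually_independent (R : realType) (d : measure_display)
    (T : measurableType d) (P : probability T R) (X : nat -> {RV P >-> R}) :=
  forall (J : seq nat) (A : nat -> set R), uniq J ->
    (forall j, j \in J -> measurable (A j)) ->
    P (\bigcap_(j in [set` J]) (X j @^-1` A j)) =
    (\prod_(j <- J) P (X j @^-1` A j))%E.

Definition identically_distributed (R : realType) (d : measure_display)
    (T : measurableType d) (P : probability T R) (X : nat -> {RV P >-> R}) :=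
  forall (i j : nat) (A : set R), measurable A ->
    distribution P (X i) A = distribution P (X j) A.

(* Only the values of [f] on [0, +oo[ are used. *)
Definition has_density (R : realType) (d : measure_display)
    (T : measurableType d) (P : probability T R) (X : {RV P >-> R})
    (f : R -> R) :=
  forall A : set R, measurable A ->
    distribution P X A =
    (\int[lebesgue_measure]_(x in A `&` `[0%R, +oo[) (f x)%:E)%E.

(* Derivative relative to [D]: one-sided at an end point of [D] that
   belongs to [D]. *)
Definition derivative_on (R : realType) (D : set R) (g g' : R -> R) :=
  forall x : R, D x ->
    (g y - g x) / (y - x) @[y --> within D x^'] --> g' x.

(* [X 0], ..., [X n.-1] is the sample of size n. *)
Definition empirical_cdf (R : realType) (T : Type) (X : nat -> T -> R)
    (n : nat) (x : R) (w : T) : R :=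
  n%:R^-1 * \sum_(i < n) (X i w <= x)%R%:R.

Definition szasz_weight (R : realType) (k : nat) (m x : R) : R :=
  expR (- (m * x)) * ((m * x) ^+ k / k`!%:R).

Definition szasz_estimator (R : realType) (T : Type) (X : nat -> T -> R)
    (m : R) (n : nat) (x : R) (w : T) : R :=
  limn (series (fun k : nat =>
    empirical_cdf X n (k%:R / m) w * szasz_weight k m x)).

Definition MISE (R : realType) (d : measure_display) (T : measurableType d)
    (P : probability T R) (X : nat -> {RV P >-> R}) (F f : R -> R) (a : R)
    (m : R) (n : nat) : \bar R :=
  'E_P[fun w => (\int[lebesgue_measure]_(x in `[0, +oo[)
     ((szasz_estimator X m n x w - F x) ^+ 2 * expR (- (a * x)) * f x))%R]%E.

Definition sigma2 (R : realType) (F : R -> R) (x : R) : R := F x * (1 - F x).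

Definition VS (R : realType) (f : R -> R) (x : R) : R :=
  f x * Num.sqrt (x / pi).

Definition bS (R : realType) (f' : R -> R) (x : R) : R := x * f' x / 2.

Definition weighted_integral (R : realType) (a : R) (f g : R -> R) : R :=
  \int[lebesgue_measure]_(x in `[0, +oo[) (g x * expR (- (a * x)) * f x).

Definition C1S (R : realType) (a : R) (F f : R -> R) : R :=
  weighted_integral a f (sigma2 F).

Definition C2S (R : realType) (a : R) (f : R -> R) : R :=
  weighted_integral a f (VS f).

Definition C3S (R : realType) (a : R) (f f' : R -> R) : R :=
  weighted_integral a f (fun x => bS f' x ^+ 2).

Definition leading_part (R : realType) (C1 C2 C3 m : R) (n : nat) : R :=
  n%:R^-1 * C1 - m `^ (- (1 / 2)) * n%:R^-1 * C2 + m `^ (- 2) * C3.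

(* [v] vanishes nowhere near [F] wherever this is used. *)
Definition is_littleo (R : realType) (U : Type) (F : set_system U)
    (u v : U -> R) :=
  `|u t / v t| @[t --> F] --> (0 : R).

(* M m n = leading_part + o(m^(-1/2) n^(-1)) + o(m^(-2)) as the real m and the
   integer n tend jointly to infinity. *)
Definition asymptotic_expansion (R : realType) (M : R -> nat -> \bar R)
    (C1 C2 C3 : R) :=
  exists r1 r2 : R * nat -> R,
    [/\ is_littleo (filter_prod (pinfty_nbhs R) \oo) r1
          (fun p => p.1 `^ (- (1 / 2)) * p.2%:R^-1),
        is_littleo (filter_prod (pinfty_nbhs R) \oo) r2
          (fun p => p.1 `^ (- 2)) &
        forall (m : R) (n : nat), 0 < m -> (0 < n)%N ->
          M m n = (leading_part C1 C2 C3 m n + r1 (m, n) + r2 (m, n))%:E].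

Definition asymptotically_optimal (R : realType) (M : R -> nat -> \bar R)
    (C1 C2 C3 : R) (n : nat) (m : R) :=
  [/\ asymptotic_expansion M C1 C2 C3, 0 < m &
      forall m' : R, 0 < m' ->
        leading_part C1 C2 C3 m n <= leading_part C1 C2 C3 m' n].

Definition m_opt (R : realType) (C2 C3 : R) (n : nat) : R :=
  n%:R `^ (2 / 3) * (4 * C3 / C2) `^ (2 / 3).

(* Main.v *)
(** The estimator at x is the average over the sample of G(X_i, x), where
    G(y, x) = P(N/m >= y) and N is a Poisson variable of mean mx.  Tonelli and
    the bias-variance decomposition give
      MISE = 1/n int (Q - S^2) w + int (S - F)^2 w,   w(x) = exp(-ax) f(x),
    where S = E F(N/m), Q = E F(min(N, N')/m) and N' is an independent copy of
    N.  A second-order Taylor expansion of F and the second and fourth central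
    moments of N give m (S - F) -> x f'/2.  As min(N, N') = (N + N' - |N - N'|)/2,
    a first-order expansion gives Q - F = - f E|N - N'| / (2m) + O(1/m).
    Conditionally on N + N' = k, the difference N - N' is a simple random walk
    after k steps, whose mean absolute value is explicit and of order
    sqrt(2k/pi) by Wallis' inequalities; hence E|N - N'| ~ 2 sqrt(mx/pi).  The
    bounds are linear or quadratic in x, so dominated convergence against w
    yields the expansion of the MISE, with a first remainder n^-1 rho(m) and a
    second one depending only on m.

    In t = m^(-1/2) the leading part is a quartic; with t0^3 = C2/(4 n C3) it
    exceeds its value at t0 by C3 (t - t0)^2 (t^2 + 2 t t0 + 3 t0^2).  The
    constant C3 is positive because f f' = 0 would make f constant. *)
Require Import Defs.
From mathcomp Require Import measurable_realfun ring lra.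

Set Implicit Arguments.
Unset Strict Implicit.
Unset Printing Implicit Defensive.

Local Open Scope classical_set_scope.
Local Open Scope ring_scope.

(** * Integration *)

(** The obstacle is that limits and domination ask for different estimates. At a fixed x the sharp
    expansion of Q has an error containing 1/sqrt(x), unbounded near 0, and the second-order
    expansion of F has no rate, as f' is only continuous. So each limit is paired with a cruder
    bound, valid for all m > 0 and polynomial in x: an expansion of order zero for Q and S in the
    variance, of order one for S in the bias. The factor exp(-ax) absorbs the growth in x, and a
    multiple of f is the integrable majorant.

    Q arises because one observation Y satisfies Y <= N/m and Y <= N'/m exactly when Y <= min(N,
    N')/m; two distinct observations give S^2 by independence.

    The only absolute moment computed is E|N - N'|; elsewhere the arithmetic-geometric mean
    inequality trades an absolute deviation for a second moment. *)

Lemma integral_probability_cst (d : measure_display) (T : measurableType d)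
  (R : realType) (P : probability T R) (c : \bar R) : (\int[P]_x c = c)%E.
Proof.
rewrite integral_cst// [X in (_ * X)%E](_ : _ = 1%E) ?mule1//.
exact: probability_setT.
Qed.

Section probability_Rintegral.
Context {d : measure_display} {T : measurableType d} {R : realType}
  (P : probability T R).
Implicit Types (g h : T -> R) (a b c : R).

Lemma Rintegral_probability_cst c : \int[P]_x c = c.
Proof. by rewrite /Rintegral integral_probability_cst. Qed.

Lemma integrable_probability_cst c : P.-integrable setT (EFin \o (fun=> c)).
Proof. exact: finite_measure_integrable_cst. Qed.

Lemma integrable_affine a b g : P.-integrable setT (EFin \o g) ->
  P.-integrable setT (EFin \o (fun x => a + b * g x)).
Proof.
move=> gi; rewrite (_ : _ \o _ = (EFin \o (fun=> a)) \+
  (fun x => b%:E * (EFin \o g) x))%E//.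
apply: integrableD => //; first exact: integrable_probability_cst.
exact: integrableZl.
Qed.

Lemma Rintegral_affine a b g : P.-integrable setT (EFin \o g) ->
  \int[P]_x (a + b * g x) = a + b * \int[P]_x g x.
Proof.
move=> gi; rewrite (@RintegralD _ _ _ P setT (fun=> a) (fun x => b * g x))//.
- by rewrite Rintegral_probability_cst RintegralZl.
- exact: integrable_probability_cst.
- rewrite (_ : _ \o _ = fun x => b%:E * (EFin \o g) x)%E//.
  exact: integrableZl.
Qed.

(** Turns a pointwise Taylor estimate into one for expectations: [h] is the Taylor polynomial and
    [e] the bound on the remainder. *)
Lemma Rintegral_dist_le g h e : P.-integrable setT (EFin \o g) ->
  P.-integrable setT (EFin \o h) -> P.-integrable setT (EFin \o e) ->
  (forall x, `|g x - h x| <= e x) ->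
  `|\int[P]_x g x - \int[P]_x h x| <= \int[P]_x e x.
Proof.
move=> gi hi ei ghe; rewrite -RintegralB//.
have ghi : P.-integrable setT (EFin \o (fun x => g x - h x)).
  rewrite (_ : _ \o _ = (EFin \o g) \- (EFin \o h))%E//.
  exact: integrableB.
rewrite (le_trans (le_normr_Rintegral _ _))//; apply: le_Rintegral => //.
exact: (@integrable_norm _ _ _ _ setT (fun x => g x - h x)).
Qed.

Lemma integrable_bounded b g : measurable_fun setT g ->
  (forall x, `|g x| <= b) -> P.-integrable setT (EFin \o g).
Proof.
move=> mg gb; apply: (@le_integrable _ _ _ P _ measurableT _ (EFin \o (fun=> b))) => //.
- exact/measurable_EFinP.
- by move=> x _; rewrite lee_fin (le_trans (gb x))// ler_norm.
- exact: integrable_probability_cst.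
Qed.

End probability_Rintegral.

Lemma integrableZl_EFin (d : measure_display) (T : measurableType d)
    (R : realType) (mu : {measure set T -> \bar R}) (D : set T) (f : T -> R)
    (c : R) : measurable D -> mu.-integrable D (EFin \o f) ->
  mu.-integrable D (EFin \o (fun x => c * f x)).
Proof.
move=> mD fi; rewrite (_ : _ \o _ = fun x => c%:E * (EFin \o f) x)%E//.
exact: integrableZl.
Qed.

Lemma integrableD_EFin (d : measure_display) (T : measurableType d)
    (R : realType) (mu : {measure set T -> \bar R}) (D : set T)
    (f g : T -> R) : measurable D -> mu.-integrable D (EFin \o f) ->
  mu.-integrable D (EFin \o g) ->
  mu.-integrable D (EFin \o (fun x => f x + g x)).
Proof.
move=> mD fi gi; rewrite (_ : _ \o _ = (EFin \o f) \+ (EFin \o g))%E//.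
exact: integrableD.
Qed.

Section product_marginals.
Context {d1 d2 : measure_display} {T1 : measurableType d1}
  {T2 : measurableType d2} {R : realType}.
Variables (P : probability T1 R) (Q : probability T2 R).

Lemma ge0_integral_prod_fst (f : T1 -> \bar R) : measurable_fun setT f ->
  (forall x, 0 <= f x)%E ->
  (\int[(P \x Q)%E]_z f z.1 = \int[P]_x f x)%E.
Proof.
move=> mf f0; rewrite (fubini_tonelli1 (fun z => f z.1))//; last first.
  exact: measurableT_comp.
apply: eq_integral => x _; rewrite /fubini_F/=.
exact: (integral_probability_cst Q).
Qed.

Lemma ge0_integral_prod_snd (f : T2 -> \bar R) : measurable_fun setT f ->
  (forall x, 0 <= f x)%E ->
  (\int[(P \x Q)%E]_z f z.2 = \int[Q]_x f x)%E.
Proof.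
move=> mf f0; rewrite (fubini_tonelli2 (fun z => f z.2))//; last first.
  exact: measurableT_comp.
apply: eq_integral => x _; rewrite /fubini_G/=.
exact: (integral_probability_cst P).
Qed.

Lemma integrable_prod_fst (f : T1 -> R) : P.-integrable setT (EFin \o f) ->
  (P \x Q)%E.-integrable setT (EFin \o (fun z => f z.1)).
Proof.
move=> /integrableP[mf fi]; apply/integrableP; split.
  exact: (measurableT_comp mf).
by rewrite (ge0_integral_prod_fst (f := fun x => `|(f x)%:E|%E))//;
  exact: measurableT_comp.
Qed.

Lemma integrable_prod_snd (f : T2 -> R) : Q.-integrable setT (EFin \o f) ->
  (P \x Q)%E.-integrable setT (EFin \o (fun z => f z.2)).
Proof.
move=> /integrableP[mf fi]; apply/integrableP; split.
  exact: (measurableT_comp mf).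
by rewrite (ge0_integral_prod_snd (f := fun x => `|(f x)%:E|%E))//;
  exact: measurableT_comp.
Qed.

Lemma Rintegral_prod_fst (f : T1 -> R) : P.-integrable setT (EFin \o f) ->
  \int[(P \x Q)%E]_z f z.1 = \int[P]_x f x.
Proof.
move=> fi; rewrite /Rintegral; congr fine.
rewrite -integral12_prod_meas1//; last exact: integrable_prod_fst.
apply: eq_integral => x _; rewrite /fubini_F/=.
exact: (integral_probability_cst Q).
Qed.

Lemma Rintegral_prod_snd (f : T2 -> R) : Q.-integrable setT (EFin \o f) ->
  \int[(P \x Q)%E]_z f z.2 = \int[Q]_x f x.
Proof.
move=> fi; rewrite /Rintegral; congr fine.
rewrite -integral21_prod_meas1//; last exact: integrable_prod_snd.
apply: eq_integral => x _; rewrite /fubini_G/=.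
exact: (integral_probability_cst P).
Qed.

End product_marginals.

(** The product sigma-algebra on pairs is discrete by countability: [A] is the countable union of
    its vertical slices. *)
Lemma measurable_nat_pair (A : set (nat * nat)) : measurable A.
Proof.
rewrite (_ : A = \bigcup_k ([set k] `*` [set l | A (k, l)])); last first.
  by apply/seteqP; split=> [[k l] ?|[k l] [i _ [/= ->]]//]; exists k.
by apply: bigcupT_measurable => k; exact: measurableX.
Qed.

Lemma measurable_fun_nat_pair (d : measure_display) (T : measurableType d)
  (f : nat * nat -> T) : measurable_fun setT f.
Proof. by move=> _ A _; exact: measurable_nat_pair. Qed.

Lemma measurable_natr_ler (d : measure_display) (T : measurableType d)
    (R : realType) (D : set T) (g h : T -> R) :
  measurable_fun D g -> measurable_fun D h ->
  measurable_fun D (fun t => (g t <= h t)%R%:R : R).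
Proof.
move=> mg mh; apply: (@measurableT_comp _ _ _ _ _ _ (fun b : bool => b%:R : R)) => //.
exact: measurable_fun_ler.
Qed.

(** By continuity [g] exceeds [g x / 2] on a ball around [x] inside the half-line, and that ball has
    positive measure. *)
Lemma Rintegral_gt0 (R : realType) (g : R -> R) (x : R) :
  (forall z : R, 0 < z -> 0 <= g z) ->
  lebesgue_measure.-integrable `]0, +oo[ (EFin \o g) ->
  0 < x -> {for x, continuous g} -> 0 < g x ->
  0 < \int[lebesgue_measure]_(z in `]0, +oo[) g z.
Proof.
move=> g0 ig x0 cg gx.
have c0 : 0 < g x / 2 by rewrite divr_gt0.
have /cvgrPdist_lt/(_ _ c0)/nbhs_ballP[e /= e0 be] := cg.
pose r := Num.min e x.
have r0 : 0 < r by rewrite lt_min e0.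
have bD : ball x r `<=` `]0, +oo[%classic.
  move=> z; rewrite /ball/= in_itv/= andbT lt_min => /andP[_].
  by rewrite ltr_distlC subrr => /andP[].
have mb : measurable (ball x r) by exact: measurable_ball.
have mg : measurable_fun (`]0, +oo[ : set R) (EFin \o g) by case/integrableP: ig.
have D0 (z : R) : `]0, +oo[%classic z -> 0 < z by rewrite /= in_itv/= andbT.
have lt0 : (0 < \int[lebesgue_measure]_(z in `]0%R, +oo[) (g z)%:E)%E.
  apply: (@lt_le_trans _ _ (\int[lebesgue_measure]_(z in ball x r) (g x / 2)%:E)%E).
    rewrite integral_cst// [X in (_ * X)%E](_ : _ = (r *+ 2)%:E).
      by rewrite -EFinM lte_fin mulr_gt0// mulrn_wgt0.
    by apply: lebesgue_measure_ball; exact: ltW.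
  apply: (@le_trans _ _ (\int[lebesgue_measure]_(z in ball x r) (g z)%:E)%E).
    apply: ge0_le_integral => //.
    - by move=> z _; rewrite lee_fin ltW.
    - exact: measurable_funS mg.
    - move=> z bz; rewrite lee_fin ltW//.
      have ze : ball x e z by apply: le_ball bz; rewrite ge_min lexx.
      by have := be _ ze; rewrite /= ltr_distlC; lra.
  by apply: ge0_subset_integral => // z /D0 z0; rewrite lee_fin g0.
(* Integrability matters here: [fine] would send an infinite integral to 0. *)
rewrite /Rintegral fine_gt0// lt0/=; apply: integrable_lty ig; exact: measurable_itv.
Qed.

(** * Series and limits *)

Lemma nneseries_shift (R : realType) (f : nat -> \bar R) (k : nat) :
  (forall i, 0 <= f i)%E -> (forall i, (i < k)%N -> f i = 0%E) ->
  (\sum_(i <oo) f i = \sum_(i <oo) f (i + k)%N)%E.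
Proof.
move=> f0 fk; rewrite nneseries_addn// (nneseries_split 0 k)//.
rewrite big_nat_cond big1 ?add0e// => i /andP[/andP[_]].
by rewrite add0n => /fk ->.
Qed.

(** Each row is shifted to start on the diagonal and padded with zeros, so that the interchange of
    two full nonnegative series applies. *)
Lemma nneseries_diagonal (R : realType) (a : nat -> nat -> \bar R) :
  (forall i j, 0 <= a i j)%E ->
  (\sum_(i <oo) \sum_(j <oo) a i j =
   \sum_(n <oo) \sum_(i < n.+1) a i (n - i)%N)%E.
Proof.
move=> a0.
pose b i n := if (i <= n)%N then a i (n - i)%N else 0%E.
have b0 i n : (0 <= b i n)%E by rewrite /b; case: ifP.
transitivity (\sum_(i <oo) \sum_(n <oo) b i n)%E.
  apply: eq_eseriesr => i _; rewrite [RHS](nneseries_shift (k := i))//.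
    by apply: eq_eseriesr => j _; rewrite /b leq_addl addnK.
  by move=> n ni; rewrite /b leqNgt ni.
rewrite nneseries_interchange//; apply: eq_eseriesr => n _.
rewrite (nneseries_split 0 n.+1)// add0n eseries0 ?adde0; last first.
  by move=> i ni _; rewrite /b leqNgt ni.
by rewrite big_mkord; apply: eq_bigr => i _; rewrite /b -ltnS ltn_ord.
Qed.

(** The constant [C] may depend on [eps]: the second-order Taylor bound provides a rate only after
    an error [eps] has been conceded. *)
Lemma cvg_of_rate (R : realType) (g : R -> R) (l : R) :
  (forall eps : R, 0 < eps -> exists C, forall m : R, 1 <= m ->
    `|g m - l| <= eps + C / Num.sqrt m) ->
  g m @[m --> +oo] --> l.
Proof.
move=> h; apply/cvgrPdist_le => e e0.
have e20 : 0 < e / 2 by rewrite divr_gt0.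
have [C hC] := h _ e20.
near=> m.
have m1 : 1 <= m by near: m; exact: nbhs_pinfty_ge.
have m0 : 0 < m by exact: lt_le_trans m1.
have s0 : 0 < Num.sqrt m by rewrite sqrtr_gt0.
rewrite distrC (le_trans (hC m m1))// [leRHS](splitr e) lerD2l.
rewrite ler_pdivrMr// -ler_pdivrMl//.
rewrite (le_trans (ler_norm _))// -[leLHS]sqrtr_sqr ler_sqrt ?(ltW m0)//.
Unshelve. all: by end_near. Qed.

Lemma bounded_on_le (R : realType) (D : set R) (g : R -> R) :
  [bounded g x | x in D] -> exists K, forall x, D x -> `|g x| <= K.
Proof.
move=> [M [_ gM]]; exists (M + 1) => x Dx; apply: (gM (M + 1)) => //.
by rewrite ltrDl.
Qed.

Lemma is_derive_nondecreasing_ge0 (R : realType) (F : R -> R) (x l : R) :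
  {homo F : x y / x <= y} -> is_derive x 1 F l -> 0 <= l.
Proof.
move=> nF [dF <-]; apply: limr_ge; first exact: dF.
near=> h; have [h0|h0] := leP 0 h.
  rewrite /GRing.scale/= mulr_ge0 ?invr_ge0// subr_ge0 nF// mulr1.
  by rewrite lerDr.
rewrite /GRing.scale/= mulr_le0 ?invr_le0 ?(ltW h0)// subr_le0 nF// mulr1.
by rewrite gerDr ltW.
Unshelve. all: by end_near. Qed.

(** * Moments of the Poisson distribution *)

Section poisson.
Context {R : realType}.
Implicit Types (l : R) (g : nat -> R).

(* The second argument of [poisson_prob] is ignored by its definition. *)
Lemma poisson_pmfE l k : 0 < l ->
  poisson_pmf l k = expR (- l) * (l ^+ k / k`!%:R).
Proof. by move=> l0; rewrite /poisson_pmf l0 mulrC. Qed.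

(** [poisson_prob] is given on sets, as a sum of [poisson_pmf]. Identifying it with a series of
    scaled Dirac masses lets the integral be computed term by term. *)
Lemma ge0_integral_poisson l g : 0 < l -> (forall k, 0 <= g k) ->
  (\int[poisson_prob l 0]_k (g k)%:E =
   \sum_(k <oo) (g k * poisson_pmf l k)%:E)%E.
Proof.
move=> l0 g0.
pose w k : {nonneg R} := NngNum (poisson_pmf_ge0 l k).
pose mu := mseries (fun k => mscale (w k) \d_k) 0.
rewrite (@eq_measure_integral _ _ _ setT mu); last first.
  move=> A mA _; rewrite /mu /mseries /= /poisson_prob l0.
  rewrite esum_mkcond -nneseries_esumT; last first.
    by move=> k; case: ifPn => // _; rewrite lee_fin poisson_pmf_ge0.
  apply: eq_eseriesr => k _.
  rewrite [RHS](_ : _ = (poisson_pmf l k)%:E * (\1_A k)%:E)%E // indicE.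
  by case: (k \in A); rewrite ?mule1 ?mule0.
rewrite ge0_integral_measure_series//; last by move=> k _; rewrite lee_fin.
apply: eq_eseriesr => k _.
rewrite ge0_integral_mscale//; last by move=> j _; rewrite lee_fin.
by rewrite integral_dirac// diracT mul1e/= -EFinM mulrC.
Qed.

(** Falling factorials suit the Poisson law: [k ^_ j] cancels against [k!] and leaves [(k - j)!].
    After dropping the [j] zero terms the series is [l ^+ j] times the total mass. *)
Lemma integral_poisson_ffact l j : 0 < l ->
  (\int[poisson_prob l 0]_k (k ^_ j)%:R%:E = (l ^+ j)%:E)%E.
Proof.
move=> l0; rewrite ge0_integral_poisson//.
rewrite (nneseries_shift (k := j)); first last.
- by move=> k kj; rewrite ffact_small// mul0r.
- by move=> k; rewrite lee_fin mulr_ge0// poisson_pmf_ge0.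
transitivity ((l ^+ j)%:E * \int[poisson_prob l 0]_k (1:R)%:E)%E; last first.
  by rewrite (integral_probability_cst (poisson_prob l 0)) mule1.
rewrite ge0_integral_poisson// -nneseriesZl; last first.
  by move=> k _; rewrite lee_fin mulr_ge0// poisson_pmf_ge0.
apply: eq_eseriesr => k _; rewrite -EFinM; congr EFin.
rewrite !poisson_pmfE// exprD.
have /(congr1 (fun n => n%:R : R)) := ffact_fact (leq_addl k j).
rewrite addnK natrM => e; rewrite -e.
have k0 : k`!%:R != 0 :> R by rewrite pnatr_eq0 -lt0n fact_gt0.
have kj0 : ((k + j) ^_ j)%:R != 0 :> R by rewrite pnatr_eq0 -lt0n ffact_gt0 leq_addl.
by field; rewrite k0.
Qed.

Lemma integrable_poisson_ffact l j : 0 < l ->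
  (poisson_prob l 0).-integrable setT (fun k => (k ^_ j)%:R%:E).
Proof.
move=> l0; apply/integrableP; split => //.
under eq_integral do rewrite gee0_abs ?lee_fin//.
by rewrite integral_poisson_ffact// ltry.
Qed.

Lemma integrable_poisson_sum_ffact l n (c : nat -> R) : 0 < l ->
  (poisson_prob l 0).-integrable setT
    (EFin \o (fun k => \sum_(j < n) c j * (k ^_ j)%:R)).
Proof.
move=> l0.
rewrite (_ : _ \o _ = fun k => (\sum_(j < n) (c j)%:E * (k ^_ j)%:R%:E)%E).
  apply: integrable_sum => // j _; apply: integrableZl => //.
  exact: integrable_poisson_ffact.
by apply/funext => k /=; rewrite -sumEFin.
Qed.

Lemma Rintegral_poisson_sum_ffact l n (c : nat -> R) : 0 < l ->
  \int[poisson_prob l 0]_k (\sum_(j < n) c j * (k ^_ j)%:R) =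
  \sum_(j < n) c j * l ^+ j.
Proof.
move=> l0; rewrite /Rintegral.
under eq_integral do rewrite -sumEFin.
have ic (j : 'I_n) : (poisson_prob l 0).-integrable setT
    (fun k => (c j * (k ^_ j)%:R)%:E).
  under eq_fun do rewrite EFinM.
  by apply: integrableZl => //; exact: integrable_poisson_ffact.
rewrite integral_sum// (eq_bigr (fun j : 'I_n => (c j * l ^+ j)%:E)) ?sumEFin//.
move=> j _; under eq_integral do rewrite EFinM.
by rewrite integralZl//; [rewrite integral_poisson_ffact|
  exact: integrable_poisson_ffact].
Qed.

Lemma natr_ffactS (k j : nat) :
  (k ^_ j.+1)%:R = (k ^_ j)%:R * (k%:R - j%:R) :> R.
Proof.
rewrite ffactnSr natrM; have [jk|kj] := leqP j k; first by rewrite natrB.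
by rewrite ffact_small// !mul0r.
Qed.

Let ffactE := (ffactn0, natr_ffactS).

(** The coefficients, here and for the fourth power, come from writing powers of [k] in falling
    factorials by Stirling numbers of the second kind; for instance k^4 has coefficients 1, 7, 6,
    1. *)
Lemma sqr_poisson_centeredE l (k : nat) : (k%:R - l) ^+ 2 =
  \sum_(j < 3) [:: l ^+ 2; 1 - 2 * l; 1]`_j * (k ^_ j)%:R.
Proof. by rewrite !big_ord_recl big_ord0 /= !ffactE /bump/=; ring. Qed.

Lemma expr4_poisson_centeredE l (k : nat) : (k%:R - l) ^+ 4 =
  \sum_(j < 5) [:: l ^+ 4; 1 - 4 * l + 6 * l ^+ 2 - 4 * l ^+ 3;
    7 - 12 * l + 6 * l ^+ 2; 6 - 4 * l; 1]`_j * (k ^_ j)%:R.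
Proof. by rewrite !big_ord_recl big_ord0 /= !ffactE /bump/=; ring. Qed.

Lemma integrable_poisson l : 0 < l ->
  (poisson_prob l 0).-integrable setT (EFin \o (fun k => k%:R)).
Proof.
move=> /(@integrable_poisson_ffact _ 1).
by under eq_fun do rewrite ffactn1.
Qed.

Lemma Rintegral_poisson l : 0 < l -> \int[poisson_prob l 0]_k k%:R = l.
Proof.
move=> l0; rewrite /Rintegral -[RHS]/(fine l%:E) -[in RHS](expr1 l).
by rewrite -integral_poisson_ffact//; under [in RHS]eq_integral do rewrite ffactn1.
Qed.

Lemma integrable_poisson_sqr l : 0 < l ->
  (poisson_prob l 0).-integrable setT (EFin \o (fun k => (k%:R - l) ^+ 2)).
Proof.
move=> l0; under [X in _ \o X]eq_fun do rewrite sqr_poisson_centeredE.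
exact: integrable_poisson_sum_ffact.
Qed.

Lemma Rintegral_poisson_sqr l : 0 < l ->
  \int[poisson_prob l 0]_k (k%:R - l) ^+ 2 = l.
Proof.
move=> l0; under eq_Rintegral do rewrite sqr_poisson_centeredE.
by rewrite Rintegral_poisson_sum_ffact// !big_ord_recl big_ord0/= /bump/=; ring.
Qed.

Lemma integrable_poisson_expr4 l : 0 < l ->
  (poisson_prob l 0).-integrable setT (EFin \o (fun k => (k%:R - l) ^+ 4)).
Proof.
move=> l0; under [X in _ \o X]eq_fun do rewrite expr4_poisson_centeredE.
exact: integrable_poisson_sum_ffact.
Qed.

Lemma Rintegral_poisson_expr4 l : 0 < l ->
  \int[poisson_prob l 0]_k (k%:R - l) ^+ 4 = 3 * l ^+ 2 + l.
Proof.
move=> l0; under eq_Rintegral do rewrite expr4_poisson_centeredE.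
by rewrite Rintegral_poisson_sum_ffact// !big_ord_recl big_ord0/= /bump/=; ring.
Qed.

End poisson.

(** * Wallis' inequalities and the simple random walk *)

Lemma Rintegral_continuous_FTC2 (R : realType) (F f : R -> R) (a b : R) :
  a < b -> (forall x : R, is_derive x 1 F (f x)) -> continuous f ->
  \int[lebesgue_measure]_(x in `[a, b]) f x = F b - F a.
Proof.
move=> ab dF cf.
have cF : continuous F.
  by move=> x; apply/differentiable_continuous/derivable1_diffP; case: (dF x).
rewrite /Rintegral (@continuous_FTC2 _ f F)//.
- exact: continuous_subspaceT.
- by split=> [x _||]; [case: (dF x)|apply: cvg_at_right_filter; exact: cF|
    apply: cvg_at_left_filter; exact: cF].
- by move=> x _; rewrite derive1E; case: (dF x).
Qed.

Section wallis.
Context {R : realType}.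

Definition wallis (n : nat) : R :=
  \int[lebesgue_measure]_(x in `[0, pi / 2]) sin x ^+ n.

(** The probability that a simple random walk is back at its origin after [j.*2] steps. *)
Definition central_binomial (j : nat) : R := 'C(j.*2, j)%:R / 2 ^+ j.*2.

Let pihalf_gt0 : 0 < pi / 2 :> R.
Proof. by rewrite divr_gt0// pi_gt0. Qed.

Let continuous_sinX n : continuous (fun x : R => sin x ^+ n).
Proof. move=> x; apply: (@continuous_comp _ _ _ sin (fun y => y ^+ n)).
  exact: continuous_sin.
exact: exprn_continuous. Qed.

Let integrable_sinX n : lebesgue_measure.-integrable `[0, pi / 2]
  (EFin \o (fun x : R => sin x ^+ n)).
Proof.
apply: continuous_compact_integrable; first exact: segment_compact.
exact/continuous_subspaceT/continuous_sinX.
Qed.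

Lemma wallis0 : wallis 0 = pi / 2.
Proof. by rewrite /wallis (@Rintegral_continuous_FTC2 _ id)// ?subr0. Qed.

Lemma wallis1 : wallis 1 = 1.
Proof.
have d (x : R) : is_derive x 1 (fun x => - cos x) (sin x ^+ 1).
  by rewrite expr1 -[X in is_derive _ _ _ X]opprK; exact: is_deriveN.
rewrite /wallis (Rintegral_continuous_FTC2 _ d)//.
by rewrite cos_pihalf cos0 oppr0 add0r opprK.
Qed.

(** The difference of the two sides is the integral of the derivative of [cos x * sin x ^+ n.+1],
    which vanishes at both end points. *)
Lemma wallisSS n : n.+2%:R * wallis n.+2 = n.+1%:R * wallis n.
Proof.
apply/eqP; rewrite eq_sym -subr_eq0 /wallis -!RintegralZl// -RintegralB//; last 2 first.
- exact: integrableZl_EFin.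
- exact: integrableZl_EFin.
have d (x : R) : is_derive x 1 (fun x => cos x * sin x ^+ n.+1)
    (n.+1%:R * sin x ^+ n - n.+2%:R * sin x ^+ n.+2).
  have := is_deriveM (is_derive_cos x) (is_deriveX n.+1 (is_derive_sin x)).
  rewrite (_ : cos * _ = fun x => cos x * sin x ^+ n.+1); last first.
    by apply/funext => y; rewrite exprfctE.
  move=> h; apply: (is_derive_eq h); rewrite /GRing.scale/=.
  have /(canRL (addrK _)) := cos2Dsin2 x.
  rewrite exprfctE; move: (sin x) (cos x) => s c c2;
  rewrite !exprS -!natr1; move: (s ^+ n) (n%:R) => p r.
  transitivity ((r + 1) * p * c ^+ 2 - s * s * p); first by ring.

  by rewrite c2; ring.
rewrite (Rintegral_continuous_FTC2 _ d)//.
  by rewrite cos_pihalf sin0 expr0n/= mulr0 mul0r subrr.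
by move=> x; apply: cvgB; apply: cvgM; [exact: cvg_cst|exact: continuous_sinX|
  exact: cvg_cst|exact: continuous_sinX].
Qed.

Lemma wallis_nonincr n : wallis n.+1 <= wallis n.
Proof.
apply: le_Rintegral => // x /=; rewrite in_itv/= => /andP[x0 xpi].
rewrite exprSr ler_piMr ?sin_le1// exprn_ge0// sin_ge0_pi//.
by rewrite x0/= (le_trans xpi)// ler_pdivrMr// ler_peMr ?pi_ge0// ler1n.
Qed.

Lemma central_binomial0 : central_binomial 0 = 1.
Proof. by rewrite /central_binomial bin0 expr0 divr1. Qed.

Lemma central_binomial_gt0 j : 0 < central_binomial j.
Proof.
by rewrite divr_gt0 ?exprn_gt0// ltr0n bin_gt0 -addnn leq_addr.
Qed.

(** The same recurrence as [wallisSS] at even indices, which ties the Wallis integrals to the return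
    probabilities. *)
Lemma central_binomialS j :
  j.*2.+2%:R * central_binomial j.+1 = j.*2.+1%:R * central_binomial j.
Proof.
have e1 : ('C(j.*2.+2, j.+1) = 'C(j.*2.+1, j) + 'C(j.*2.+1, j))%N.
  rewrite binS -[X in (X + _)%N]bin_sub; last by rewrite ltnS -addnn leq_addr.
  by rewrite subSS -[X in (X - j)%N]addnn addnK.
have e2 : (j.+1 * 'C(j.*2.+1, j) = j.*2.+1 * 'C(j.*2, j))%N.
  have /= -> := mul_bin_down j.*2.+1 j.
  by rewrite -[X in (X.+1 - _)%N]addnn subSn ?leq_addr// addnK.
rewrite /central_binomial doubleS e1 natrD !exprS.
have {}e2 := congr1 (fun n => n%:R : R) e2; rewrite /= !natrM in e2.
rewrite [in RHS]mulrA -e2 -doubleS -muln2 natrM.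
by field; rewrite expf_neq0.
Qed.

Lemma wallis_even j : wallis j.*2 = pi / 2 * central_binomial j.
Proof.
elim: j => [|j ih]; first by rewrite wallis0 central_binomial0 mulr1.
have n0 : j.*2.+2%:R != 0 :> R by rewrite pnatr_eq0.
apply: (mulfI n0); rewrite doubleS wallisSS ih mulrCA -central_binomialS; ring.
Qed.

Lemma wallis_odd j : j.*2.+1%:R * wallis j.*2.+1 * central_binomial j = 1.
Proof.
elim: j => [|j ih]; first by rewrite central_binomial0 wallis1 !mulr1.
rewrite -[RHS]ih doubleS wallisSS; apply/eqP; rewrite -subr_eq0; apply/eqP.
transitivity ((j.*2.+2%:R * central_binomial j.+1 -
  j.*2.+1%:R * central_binomial j) * wallis j.*2.+1); first by ring.
by rewrite central_binomialS subrr mul0r.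
Qed.

(** Multiply [wallis j.*2.+1 <= wallis j.*2] by [j.*2.+1%:R * central_binomial j]: the left side
    becomes 1 by [wallis_odd]. *)
Lemma sqr_central_binomial_ge j :
  2 <= pi * j.*2.+1%:R * central_binomial j ^+ 2.
Proof.
have := wallis_nonincr j.*2; rewrite wallis_even => le.
have := wallis_odd j.
have := central_binomial_gt0 j; move: (central_binomial j) le => c le c0 e.
rewrite -(ler_pM2r (_ : 0 < j.*2.+1%:R * c)) in le; last by rewrite mulr_gt0.
rewrite [leLHS](_ : _ = 1) in le; last by rewrite -[RHS]e; ring.
by rewrite -[leLHS]mul1r -ler_pdivlMr// (le_trans le)//; lra.
Qed.

(** The neighbouring comparison, of [wallis j.*2.+2] with [wallis j.*2.+1], now has 1 on the right;
    it bounds the return probability of index [j.+1]. *)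
Lemma sqr_central_binomial_le j : pi * j%:R * central_binomial j ^+ 2 <= 1.
Proof.
case: j => [|j]; first by rewrite mulr0 mul0r.
have := wallis_nonincr j.*2.+1; rewrite -doubleS wallis_even => le.
have := wallis_odd j.
have := central_binomialS j; have := central_binomial_gt0 j.+1.
move: (central_binomial j) (central_binomial j.+1) le => c c' le c'0 cc' e.
rewrite -(ler_pM2r (_ : 0 < j.*2.+2%:R * c')) in le; last by rewrite mulr_gt0.
rewrite [leRHS](_ : _ = 1) in le; last by rewrite cc' -[RHS]e; ring.
apply: le_trans le; rewrite -doubleS -muln2 natrM le_eqVlt; apply/orP; left.
by apply/eqP; field.
Qed.

End wallis.

Section random_walk.
Context {R : realType}.

(* E|S_n| for the simple random walk, [k] counting the steps to the left. *)
Definition mean_abs_walk (n : nat) : R :=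
  (\sum_(k < n.+1) 'C(n, k)%:R * `|n%:R - k.*2%:R|) / 2 ^+ n.

(** Pascal's rule, read as conditioning the walk on one more step. *)
Lemma sum_binomialS n (h : nat -> R) :
  \sum_(k < n.+2) 'C(n.+1, k)%:R * h k =
  \sum_(k < n.+1) 'C(n, k)%:R * (h k + h k.+1).
Proof.
rewrite big_ord_recl/= bin0 mul1r.
under eq_bigr do rewrite /bump/= add1n binS natrD mulrDl.
under [RHS]eq_bigr do rewrite mulrDr.
rewrite !big_split/= addrA; congr (_ + _).
rewrite [in RHS]big_ord_recl/= bin0 mul1r; congr (_ + _).
by rewrite big_ord_recr/= bin_small// mul0r addr0.
Qed.

(** With y = n - 2k this is |y + 1| + |y - 1| = 2|y|, plus 2 when y = 0: only at the origin does a
    step change the mean distance. *)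
Let walk_step (n k : nat) :
  `|n.+1%:R - k.*2%:R| + `|n.+1%:R - k.+1.*2%:R| =
  2 * `|n%:R - k.*2%:R| + 2 * (n == k.*2)%:R :> R.
Proof.
rewrite doubleS -!natr1; have [nk|nk|->] := ltngtP n k.*2.
- have := nk; rewrite -(ler_nat R) -natr1 => h.
  by rewrite mulr0n !ler0_norm; lra.
- have := nk; rewrite -(ler_nat R) -natr1 => h.
  by rewrite mulr0n !ger0_norm; lra.
- rewrite subrr normr0 (_ : _ - _ = 1); last by ring.
  rewrite (_ : _ - _ = -1); last by ring.
  by rewrite normrN normr1 mulr1n; ring.
Qed.

Lemma mean_abs_walkS n : mean_abs_walk n.+1 = mean_abs_walk n +
  if odd n then 0 else central_binomial n./2.
Proof.
rewrite /mean_abs_walk (sum_binomialS n (fun k => `|n.+1%:R - k.*2%:R|)).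
under eq_bigr do rewrite walk_step.
under eq_bigr do rewrite mulrDr.
rewrite big_split/=.
under eq_bigr do rewrite mulrCA.
rewrite -mulr_sumr mulrDl exprS; congr (_ + _); first by field; rewrite expf_neq0.
have [on|en] := boolP (odd n).
  rewrite big1 ?mul0r// => k _; case: eqP => [nk|_]; last by rewrite !mulr0.
  by have := odd_double k; rewrite -nk on.
have nE : n = n./2.*2 by rewrite -[LHS]odd_double_half (negbTE en).
have n2 : (n./2 < n.+1)%N by rewrite ltnS [leqRHS]nE -addnn leq_addr.
rewrite (bigD1 (Ordinal n2))//= big1 ?addr0; last first.
  move=> k /eqP kn; case: eqP => [nk|_]; last by rewrite !mulr0.
  by case: kn; apply/val_inj; rewrite /= [in RHS]nk doubleK.
rewrite -nE eqxx mulr1n /central_binomial -nE; field; by rewrite expf_neq0.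
Qed.

(** Both parities go through one induction. From [j.*2.+1] to [j.*2.+2] the mean is unchanged, the
    walk being away from 0 at odd times, and [central_binomialS] rewrites the value. *)
Lemma mean_abs_walk_double j :
  mean_abs_walk j.*2 = j.*2%:R * central_binomial j /\
  mean_abs_walk j.*2.+1 = j.*2.+1%:R * central_binomial j.
Proof.
have oddE i : mean_abs_walk i.*2 = i.*2%:R * central_binomial i ->
    mean_abs_walk i.*2.+1 = i.*2.+1%:R * central_binomial i.
  by move=> e; rewrite mean_abs_walkS odd_double doubleK e -natr1; ring.
elim: j => [|j [_ ih]].
  have e : mean_abs_walk 0 = 0%:R * central_binomial 0.
    rewrite /mean_abs_walk big_ord_recl big_ord0 /= subrr normr0 mulr0 !mul0r.
    by rewrite addr0 mul0r.
  by split => //; exact: oddE.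
have e : mean_abs_walk j.+1.*2 = j.+1.*2%:R * central_binomial j.+1.
  by rewrite doubleS mean_abs_walkS/= odd_double ih addr0 central_binomialS.
by split => //; exact: oddE.
Qed.

Lemma mean_abs_walk_ge0 n : 0 <= mean_abs_walk n.
Proof. by rewrite divr_ge0 ?exprn_ge0// sumr_ge0// => k _; rewrite mulr_ge0. Qed.

(* E|S_n| is [2 j w] for [n = 2 j] and [(2 j + 1) w] for [n = 2 j + 1], where
   [w] is the [j]-th central binomial probability; Wallis bounds [w]. *)
Lemma sqr_mean_abs_walk n : `|mean_abs_walk n ^+ 2 - 2 * n%:R / pi| <= 2.
Proof.
have := @sqr_central_binomial_le R n./2.
have := @sqr_central_binomial_ge R n./2.
have := pi_ge2 R; move: pi => p p2.
move=> cge cle; have p0 : 0 < p by lra.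
rewrite -(ler_pM2l p0) -[X in X * _ <= _](gtr0_norm p0) -normrM.
rewrite [X in `|X|](_ : _ = p * mean_abs_walk n ^+ 2 - 2 * n%:R); last first.
  by field; rewrite gt_eqF.
move: (odd_double_half n) cge cle (mean_abs_walk_double n./2).
move: n./2 (odd n) => j b <- cge cle [].
have e2 : j.*2%:R = 2 * j%:R :> R by rewrite -muln2 natrM mulrC.
have e1 : j.*2.+1%:R = 2 * j%:R + 1 :> R by rewrite -natr1 e2.
move: cge cle; case: b; rewrite ?add0n ?add1n.
  (* Odd [n] comes first. At [j = 0] the upper Wallis bound is void, so the single step is checked
     directly: |p - 2| <= 2p. *)
  rewrite e1 => + + _ ->; case: j {e1 e2} => [_ _|j].
    rewrite central_binomial0 mulr0 add0r !mulr1 expr1n ler_norml.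
    by apply/andP; split; lra.
  move: (central_binomial j.+1) => c.
  set J : R := j.+1%:R; have J1 : 1 <= J by rewrite ler1n.
  move=> h1 h2.
  rewrite exprMn ler_norml; apply/andP; split; first by nra.
  nra.
rewrite e1 e2 => + + -> _; move: (central_binomial j) => c.
set J : R := j%:R; have J0 : 0 <= J by rewrite ler0n.
move=> h1 h2.
rewrite exprMn ler_norml; apply/andP; split; nra.
Qed.

End random_walk.

(** * Mean distance of two independent Poisson variables *)

Section poisson_pair.
Context {R : realType}.
Implicit Types (l : R).

Definition poisson2 l : probability _ R :=
  (poisson_prob l 0 \x poisson_prob l 0)%E.

Lemma ge0_integral_poisson2 l (h : nat -> nat -> R) : 0 < l ->
  (forall i j, 0 <= h i j) ->
  (\int[poisson2 l]_z (h z.1 z.2)%:E =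
   \sum_(i <oo) \sum_(j <oo)
     (h i j * poisson_pmf l j * poisson_pmf l i)%:E)%E.
Proof.
move=> l0 h0; rewrite /poisson2 fubini_tonelli1//; last 2 first.
- exact: measurable_fun_nat_pair.
- by move=> x; rewrite lee_fin.
rewrite /fubini_F/=.
have hp0 i j : (0 <= (h i j * poisson_pmf l j)%:E)%E.
  by rewrite lee_fin mulr_ge0// poisson_pmf_ge0.
have p0 i : (0 <= (poisson_pmf l i)%:E)%E by rewrite lee_fin poisson_pmf_ge0.
under eq_integral do rewrite ge0_integral_poisson//.
rewrite integral_nneseries//.
transitivity (\sum_(j <oo) \sum_(i <oo)
    (h i j * poisson_pmf l j * poisson_pmf l i)%:E)%E.
  apply: eq_eseriesr => j _; rewrite ge0_integral_poisson//.
  by move=> i; exact: hp0.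
by rewrite nneseries_interchange// => i j; rewrite EFinM mule_ge0.
Qed.

(** N + N' is Poisson of mean [2 * l], and given N + N' = n the variable N is binomial with
    parameters n and 1/2. *)
Lemma poisson_pmf_diagonal l n i : 0 < l -> (i <= n)%N ->
  poisson_pmf l i * poisson_pmf l (n - i)%N =
  'C(n, i)%:R / 2 ^+ n * poisson_pmf (2 * l) n.
Proof.
move=> l0 ni; have l20 : 0 < 2 * l by rewrite mulr_gt0.
rewrite !poisson_pmfE// exprMn (_ : - (2 * l) = - l + - l); last by ring.
rewrite expRD.
have /(congr1 (fun n => n%:R : R)) := bin_fact ni; rewrite /= !natrM => <-.
rewrite (_ : l ^+ n = l ^+ i * l ^+ (n - i)); last by rewrite -exprD subnKC.
have f0 k : k`!%:R != 0 :> R by rewrite pnatr_eq0 -lt0n fact_gt0.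
have C0 : 'C(n, i)%:R != 0 :> R by rewrite pnatr_eq0 -lt0n bin_gt0.
by field; rewrite !f0 C0 expf_neq0.
Qed.

(* Conditionally on N + N' = n, the difference N - N' is the position of a
   simple random walk after n steps. *)
Lemma integral_poisson2_dist l : 0 < l ->
  (\int[poisson2 l]_z (`|z.1%:R - z.2%:R|)%:E =
   \int[poisson_prob (2 * l) 0]_n (mean_abs_walk n)%:E)%E.
Proof.
move=> l0; rewrite (ge0_integral_poisson2 (h := fun i j => `|i%:R - j%:R|))//.
rewrite nneseries_diagonal; last first.
  by move=> i j; rewrite lee_fin !mulr_ge0// poisson_pmf_ge0.
rewrite ge0_integral_poisson ?mulr_gt0//; last exact: mean_abs_walk_ge0.
apply: eq_eseriesr => n _; rewrite sumEFin; congr EFin.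
rewrite /mean_abs_walk !mulr_suml; apply: eq_bigr => i _.
have ni : (i <= n)%N by rewrite -ltnS.
rewrite -mulrA [X in _ * X]mulrC poisson_pmf_diagonal//.
rewrite (_ : i%:R - (n - i)%:R = - (n%:R - i.*2%:R)); last first.
  by rewrite natrB// -addnn natrD; ring.
by rewrite normrN; ring.
Qed.

Lemma integrable_poisson2_dist l : 0 < l ->
  (poisson2 l).-integrable setT (EFin \o (fun z => `|z.1%:R - z.2%:R|)).
Proof.
move=> l0; have il := integrable_poisson l0.
apply: (@le_integrable _ _ _ (poisson2 l) _ measurableT _
   (EFin \o (fun z => z.1%:R + z.2%:R))) => //.
- exact: measurable_fun_nat_pair.
- move=> z _ /=; rewrite lee_fin normr_id [leRHS]ger0_norm ?addr_ge0//.
  by rewrite (le_trans (ler_normB _ _))// !ger0_norm.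
- rewrite (_ : _ \o _ = (EFin \o (fun z => z.1%:R)) \+
    (EFin \o (fun z => z.2%:R)))%E//.
  by apply: integrableD => //; [exact: integrable_prod_fst|
    exact: integrable_prod_snd].
Qed.

Lemma integrable_mean_abs_walk l : 0 < l ->
  (poisson_prob (2 * l) 0).-integrable setT (EFin \o mean_abs_walk).
Proof.
move=> l0; apply/integrableP; split => //.
under eq_integral do rewrite /= ger0_norm ?mean_abs_walk_ge0//.
rewrite -integral_poisson2_dist//.
have /integrableP[_] := integrable_poisson2_dist l0.
by under eq_integral do rewrite /= normr_id.
Qed.

Lemma Rintegral_poisson2_dist l : 0 < l ->
  `|\int[poisson2 l]_z `|z.1%:R - z.2%:R| - 2 * Num.sqrt (l / pi)| <=
  1 + (Num.sqrt (l / pi))^-1.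
Proof.
move=> l0.
set q := Num.sqrt (l / pi).
have pi0 : 0 < pi :> R := pi_gt0 R.
have q0 : 0 < q by rewrite sqrtr_gt0 divr_gt0.
have lE : l = pi * q ^+ 2.
  by rewrite sqr_sqrtr ?ltW ?divr_gt0// mulrC divfK// gt_eqF.
have -> : \int[poisson2 l]_z `|z.1%:R - z.2%:R| =
    \int[poisson_prob (2 * l) 0]_n mean_abs_walk n.
  by rewrite /Rintegral integral_poisson2_dist.
have l20 : 0 < 2 * l by rewrite mulr_gt0.
(* The deviation t = n - 2l is split as |t| <= (t^2/(pi q) + pi q)/2; the weight pi q = sqrt(pi l)
   has the order of the standard deviation of n. The mean of [h] is 1/q + 1/2 + 1/pi, and pi >= 2
   concludes. *)
pose h n := (q^-1 + 2^-1) + (2 * (pi * q) ^+ 2)^-1 * (n%:R - 2 * l) ^+ 2.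
have i2 := integrable_poisson_sqr l20.
apply: (@le_trans _ _ (\int[poisson_prob (2 * l) 0]_n h n)); last first.
  rewrite Rintegral_affine// Rintegral_poisson_sqr// lE.
  have := pi_ge2 R; move: pi pi0 {h l0 l20 i2 lE} => p p0 p2.
  rewrite [leLHS](_ : _ = q^-1 + 2^-1 + p^-1); last by field; rewrite !gt_eqF.
  have : p^-1 <= 2^-1 by rewrite -[leLHS]mul1r ler_pdivrMr//; lra.
  lra.
rewrite -[X in `|_ - X|](Rintegral_probability_cst (poisson_prob (2 * l) 0)).
apply: Rintegral_dist_le; [exact: integrable_mean_abs_walk|
  exact: integrable_probability_cst|exact: integrable_affine|move=> n].
have g0 := @mean_abs_walk_ge0 R n; have := @sqr_mean_abs_walk R n.
rewrite /h {h i2 l20 l0}; move: (mean_abs_walk n) g0 => g g0.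
rewrite lE; have {lE} := pi_ge2 R; move: (@pi R) pi0 => p p0 p2; move: n%:R => x gx.
(* [|g - 2 q| <= |g ^ 2 - 4 q ^ 2| / (2 q)], then AM-GM *)
have q20 : 0 < 2 * q by lra.
have gq : `|g - 2 * q| * (2 * q) <= `|g ^+ 2 - 4 * q ^+ 2|.
  rewrite (_ : g ^+ 2 - 4 * q ^+ 2 = (g - 2 * q) * (g + 2 * q)); last by ring.
  by rewrite normrM ler_wpM2l// [leRHS]ger0_norm; lra.
set t := x - 2 * (p * q ^+ 2).
have xt : `|t| <= (t ^+ 2 / (p * q) + p * q) / 2.
  have pq : 0 < p * q by rewrite mulr_gt0.
  rewrite ler_pdivlMr// -(ler_pM2r pq) mulrDl divfK ?gt_eqF//.
  have := sqr_ge0 (`|t| - p * q); rewrite -(real_normK (num_real t)).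
  by move: (`|t|) => u; nra.
have gt : `|g ^+ 2 - 4 * q ^+ 2| <= 2 + 2 / p * `|t|.
  rewrite (_ : _ - _ = (g ^+ 2 - 2 * x / p) + 2 / p * t); last first.
    by rewrite /t; field; rewrite gt_eqF.
  rewrite (le_trans (ler_normD _ _))// lerD// normrM ler_wpM2r//.
  by rewrite ger0_norm// divr_ge0// ltW.
rewrite -(ler_pM2r q20) (le_trans gq)// (le_trans gt)//.
apply: (@le_trans _ _ (2 + 2 / p * ((t ^+ 2 / (p * q) + p * q) / 2))).
  by rewrite lerD2l ler_wpM2l// divr_ge0// ltW.
by rewrite le_eqVlt; apply/orP; left; apply/eqP; field; rewrite !gt_eqF.
Qed.

End poisson_pair.

(** * Taylor expansion on the positive half-line *)

Lemma is_derive_derivative_on (R : realType) (D : set R) (g g' : R -> R) (x : R) :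
  derivative_on D g g' -> nbhs x D -> is_derive x 1 g (g' x).
Proof.
move=> dg Dx.
suff h : (fun h => h^-1 *: (g (h *: 1 + x) - g x)) @ 0^' --> g' x.
  split; first by apply/cvg_ex; exists (g' x).
  exact/cvg_lim.
apply: (@cvg_trans _ ((fun y => (g y - g x) / (y - x)) @ within D x^')); last first.
  exact: (dg x (nbhs_singleton Dx)).
move=> A /= [e /= e0 eA].
have /nbhs_ballP[e' /= e'0 e'D] := Dx.
exists (Num.min e e'); first by rewrite /= lt_min e0.
move=> h /=; rewrite sub0r normrN lt_min => /andP[he he'] h0.
have hx : h *: 1 + x - x = h by rewrite addrK /GRing.scale/= mulr1.
have -> : h^-1 *: (g (h *: 1 + x) - g x) =
    (g (h *: 1 + x) - g x) / (h *: 1 + x - x) by rewrite hx mulrC.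
have xh : `|x - (h *: 1 + x)| = `|h| by rewrite distrC hx.
apply: eA; first by rewrite /= xh.
- by rewrite -subr_eq0 hx.
- by apply: e'D; rewrite /ball/= xh.
Qed.

Section taylor_positive.
Context {R : realType}.
Implicit Types (G g : R -> R) (x u c : R).

Lemma derive_continuous G x d : is_derive x 1 G d -> {for x, continuous G}.
Proof.
by case=> dG _; apply: differentiable_continuous; exact/derivable1_diffP.
Qed.

(** The point [u] may be 0, as a Poisson variable may vanish. There [G] is only known to be
    continuous, yet [c] stays positive. Both orders of [u] and [x] are covered. *)
Lemma mvt_positive G g x u : (forall z : R, 0 < z -> is_derive z 1 G (g z)) ->
  {for u, continuous G} -> 0 < x -> 0 <= u ->
  exists c, [/\ 0 < c, `|c - x| <= `|u - x| & G u - G x = g c * (u - x)].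
Proof.
move=> dG cu x0 u0.
have [xu|ux|xu] := ltgtP x u; last first.
- by exists x; rewrite -xu !subrr mulr0 normr0.
- have [] := @MVT _ G g u x ux.
  + by move=> z; rewrite in_itv/= => /andP[uz _]; apply: dG; exact: le_lt_trans uz.
  + apply: continuous_in_subspaceT => z; rewrite inE/= in_itv/= => /andP[].
    rewrite le_eqVlt => /predU1P[<-//|uz _].
    by apply: derive_continuous (dG _ _); exact: le_lt_trans uz.
  move=> c; rewrite in_itv/= => /andP[uc cx] e; exists c; split.
  + exact: le_lt_trans uc.
  + by rewrite !ltr0_norm; lra.
  + by rewrite -opprB e; ring.
- have [] := @MVT _ G g x u xu.
  + by move=> z; rewrite in_itv/= => /andP[xz _]; apply: dG; exact: lt_trans xz.
  + apply: continuous_in_subspaceT => z; rewrite inE/= in_itv/= => /andP[xz _].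
    by apply: derive_continuous (dG _ _); exact: lt_le_trans xz.
  move=> c; rewrite in_itv/= => /andP[xc cu'] e; exists c; split => //.
  + exact: lt_trans xc.
  + by rewrite !gtr0_norm; lra.
Qed.

Variables (F f f' : R -> R) (K0 K1 : R).
Hypothesis F_continuous : continuous F.
Hypothesis dF : forall z : R, 0 < z -> is_derive z 1 F (f z).
Hypothesis df : forall z : R, 0 < z -> is_derive z 1 f (f' z).
Hypothesis f'_continuous : forall z : R, 0 < z -> {for z, continuous f'}.
Hypothesis f_le : forall z : R, 0 < z -> `|f z| <= K0.
Hypothesis f'_le : forall z : R, 0 < z -> `|f' z| <= K1.

Lemma taylor0 x u : 0 < x -> 0 <= u -> `|F u - F x| <= K0 * `|u - x|.
Proof.
move=> x0 u0; have [c [c0 _ ->]] := mvt_positive dF (@F_continuous u) x0 u0.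
by rewrite normrM ler_wpM2r// f_le.
Qed.

Lemma taylor1 x u : 0 < x -> 0 <= u ->
  `|F u - (F x + f x * (u - x))| <= K1 * (u - x) ^+ 2.
Proof.
move=> x0 u0; have [c [c0 cx e]] := mvt_positive dF (@F_continuous u) x0 u0.
have [c' [c'0 _ e']] := mvt_positive df (derive_continuous (df c0)) x0 (ltW c0).
rewrite (_ : _ - _ = (F u - F x) - f x * (u - x)); last by ring.
rewrite e -mulrBl e' !normrM -mulrA -real_normK ?num_real// expr2.
by rewrite ler_pM// ?f'_le// ler_wpM2r.
Qed.

(** Near [x], continuity of [f'] yields the factor [eps]. At distance at least [e] the increment of
    [f'] is at most 2 K1 <= 2 K1 (u - x)^2 / e^2, whence the fourth power. *)
Lemma taylor2 x eps : 0 < x -> 0 < eps -> exists2 K, 0 <= K & forall u, 0 <= u ->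
  `|F u - (F x + f x * (u - x) + f' x / 2 * (u - x) ^+ 2)| <=
  eps * (u - x) ^+ 2 + K * (u - x) ^+ 4.
Proof.
move=> x0 eps0.
have /cvgrPdist_le /(_ _ eps0) := f'_continuous x0.
move=> /nbhs_ballP[e /= e0 be].
have K10 : 0 <= K1 by rewrite (le_trans _ (f'_le x0)).
exists (2 * K1 / e ^+ 2); first by rewrite divr_ge0 ?exprn_ge0 ?mulr_ge0// ltW.
move=> u u0.
(* The mean value theorem is applied to the remainder [H], then to [f]; the factor f' c' - f' x
   appears, with c' no farther from [x] than [u]. *)
pose H y := F y - (F x + f x * (y - x) + f' x / 2 * (y - x) ^+ 2).
have dH (z : R) : 0 < z -> is_derive z 1 H (f z - f x - f' x * (z - x)).
  move=> z0.
  have dz : is_derive z 1 (id - cst x : R -> R) 1.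
    by apply: is_derive_eq; rewrite subr0.
  have h := is_deriveB (dF z0) (is_deriveD (is_deriveD (is_derive_cst (F x) z 1)
    (is_deriveZ (f x) dz)) (is_deriveZ (f' x / 2) (is_deriveX 2 dz))).
  have HE : H = F - (cst (F x) + f x \*: (id - cst x) +
    (f' x / 2) \*: (id - cst x) ^+ 2) by apply/funext.
  by rewrite HE; apply: (is_derive_eq h); rewrite /GRing.scale/= !fctE; field.
have cH : {for u, continuous H}.
  apply: cvgB; first exact: F_continuous.
  by apply: cvgD; [apply: cvgD|]; [exact: cvg_cst| |]; apply: cvgM;
    try exact: cvg_cst; try (apply: cvgB; [exact: cvg_id|exact: cvg_cst]);
    apply: cvgM; apply: cvgB; [exact: cvg_id|exact: cvg_cst
      |exact: cvg_id|exact: cvg_cst].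
have [c [c0 cx e1]] := mvt_positive dH cH x0 u0.
have [c' [c'0 c'x e2]] := mvt_positive df (derive_continuous (df c0)) x0 (ltW c0).
rewrite -/(H u).
have -> : H u = (f' c' - f' x) * (c - x) * (u - x).
  by rewrite mulrBl -e2 -e1 /H subrr; ring.
have bound : `|f' c' - f' x| <= eps + 2 * K1 / e ^+ 2 * (u - x) ^+ 2.
  have [ue|eu] := ltP `|u - x| e.
    apply: (@le_trans _ _ eps); last first.
      by rewrite lerDl mulr_ge0 ?sqr_ge0// divr_ge0 ?exprn_ge0 ?mulr_ge0// ltW.
    rewrite distrC; apply: be; rewrite /ball/= distrC.
    by rewrite (le_lt_trans c'x)// (le_lt_trans cx).
  apply: (@le_trans _ _ (2 * K1)).
    rewrite (le_trans (ler_normB _ _))// mulr_natl mulr2n lerD// f'_le//.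
  rewrite (le_trans _ (_ : 2 * K1 / e ^+ 2 * (u - x) ^+ 2 <= _))//; last first.
    by rewrite lerDr ltW.
  rewrite -mulrA ler_peMr ?mulr_ge0// ler_pdivlMl ?exprn_gt0// mulr1.
  by rewrite -[leRHS]real_normK ?num_real// lerXn2r// ?nnegrE// ltW.
rewrite !normrM -mulrA [leRHS](_ : _ = (eps + 2 * K1 / e ^+ 2 * (u - x) ^+ 2) *
    (u - x) ^+ 2); last by ring.
by rewrite ler_pM// ?mulr_ge0// -[leRHS]real_normK ?num_real// expr2 ler_wpM2r.
Qed.

End taylor_positive.

(** * Pointwise bias and variance of the Szasz estimator *)

Section scaled_poisson.
Context {R : realType}.
Variables (m x : R).
Hypotheses (m0 : 0 < m) (x0 : 0 < x).

Let mx0 : 0 < m * x. Proof. exact: mulr_gt0. Qed.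
Let m_neq0 : m != 0. Proof. by rewrite gt_eqF. Qed.

Local Notation dev k := (k%:R / m - x).

(** One template for the Taylor polynomials and for the remainder bounds alike. The term in [b] has
    mean zero. *)
Lemma scaled_poisson_moments (a b c e : R) :
  (poisson_prob (m * x) 0).-integrable setT
    (EFin \o (fun k => a + b * dev k + c * dev k ^+ 2 + e * dev k ^+ 4)) /\
  \int[poisson_prob (m * x) 0]_k
    (a + b * dev k + c * dev k ^+ 2 + e * dev k ^+ 4) =
  a + c * (x / m) + e * ((3 * x ^+ 2 + x / m) / m ^+ 2).
Proof.
pose g1 k : R := (a - b * x) + b / m * k%:R.
pose g2 (k : nat) := c / m ^+ 2 * (k%:R - m * x) ^+ 2.
pose g3 (k : nat) := e / m ^+ 4 * (k%:R - m * x) ^+ 4.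
have -> : (fun k => a + b * dev k + c * dev k ^+ 2 + e * dev k ^+ 4) =
    (fun k => g1 k + g2 k + g3 k).
  by apply/funext => k; rewrite /g1 /g2 /g3; field.
have i1 : (poisson_prob (m * x) 0).-integrable setT (EFin \o g1).
  by apply: integrable_affine; exact: integrable_poisson.
have i2 : (poisson_prob (m * x) 0).-integrable setT (EFin \o g2).
  by apply: integrableZl_EFin => //; exact: integrable_poisson_sqr.
have i3 : (poisson_prob (m * x) 0).-integrable setT (EFin \o g3).
  by apply: integrableZl_EFin => //; exact: integrable_poisson_expr4.
have i12 := integrableD_EFin measurableT i1 i2.
split; first exact: integrableD_EFin.
rewrite (RintegralD _ i12 i3)// (RintegralD _ i1 i2)//.
rewrite Rintegral_affine; last exact: integrable_poisson.
rewrite Rintegral_poisson// RintegralZl//; last exact: integrable_poisson_sqr.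
rewrite Rintegral_poisson_sqr// RintegralZl//; last exact: integrable_poisson_expr4.
by rewrite Rintegral_poisson_expr4//; field.
Qed.

Lemma scaled_poisson2_moments (a b c e : R) :
  (poisson2 (m * x)).-integrable setT (EFin \o (fun z =>
    a + b * (dev z.1 + dev z.2) + c * (dev z.1 ^+ 2 + dev z.2 ^+ 2) +
    e * `|z.1%:R - z.2%:R|)) /\
  \int[poisson2 (m * x)]_z
    (a + b * (dev z.1 + dev z.2) + c * (dev z.1 ^+ 2 + dev z.2 ^+ 2) +
     e * `|z.1%:R - z.2%:R|) =
  a + 2 * c * (x / m) + e * \int[poisson2 (m * x)]_z `|z.1%:R - z.2%:R|.
Proof.
pose g k := a / 2 + b * dev k + c * dev k ^+ 2 + 0 * dev k ^+ 4.
have [ig Ig] := scaled_poisson_moments (a / 2) b c 0.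
have i1 := integrable_prod_fst (poisson_prob (m * x) 0) ig.
have i2 := integrable_prod_snd (poisson_prob (m * x) 0) ig.
have i3 := integrableZl_EFin e measurableT (integrable_poisson2_dist mx0).
have i12 := integrableD_EFin measurableT i1 i2.
have -> : (fun z : nat * nat => a + b * (dev z.1 + dev z.2) +
      c * (dev z.1 ^+ 2 + dev z.2 ^+ 2) + e * `|z.1%:R - z.2%:R|) =
    (fun z => g z.1 + g z.2 + e * `|z.1%:R - z.2%:R|).
  by apply/funext => z; rewrite /g; field.
split; first exact: integrableD_EFin.
rewrite (RintegralD _ i12 i3)// (RintegralD _ i1 i2)//.
rewrite (Rintegral_prod_fst _ ig) (Rintegral_prod_snd _ ig) Ig.
rewrite RintegralZl//; last exact: integrable_poisson2_dist.
by field.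
Qed.

End scaled_poisson.

Section szasz_pointwise.
Context {R : realType}.
Variables (F f f' : R -> R) (K0 K1 : R).
Hypothesis F_continuous : continuous F.
Hypothesis F_itv : forall z, 0 <= F z <= 1.
Hypothesis dF : forall z : R, 0 < z -> is_derive z 1 F (f z).
Hypothesis df : forall z : R, 0 < z -> is_derive z 1 f (f' z).
Hypothesis f'_continuous : forall z : R, 0 < z -> {for z, continuous f'}.
Hypothesis f_le : forall z : R, 0 < z -> `|f z| <= K0.
Hypothesis f'_le : forall z : R, 0 < z -> `|f' z| <= K1.

(* First and second moments of [szasz_kernel m Y x] for [Y] distributed
   according to [F]: E F(N/m) and E F(min(N, N')/m), where N and N' are
   independent Poisson variables of mean [m x]. *)
Definition szasz_mean (m x : R) : R :=
  \int[poisson_prob (m * x) 0]_k F (k%:R / m).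

Definition szasz_sqr (m x : R) : R :=
  \int[poisson2 (m * x)]_z F ((minn z.1 z.2)%:R / m).

Variable x : R.
Hypothesis x0 : 0 < x.

Let K00 : 0 <= K0. Proof. by rewrite (le_trans _ (f_le x0)). Qed.
Let K10 : 0 <= K1. Proof. by rewrite (le_trans _ (f'_le x0)). Qed.

Let F_norm z : `|F z| <= 1.
Proof. by have /andP[F0 F1] := F_itv z; rewrite ger0_norm. Qed.

Section fixed_m.
Variable m : R.
Hypothesis m0 : 0 < m.

Let mx0 : 0 < m * x. Proof. exact: mulr_gt0. Qed.

Let s := Num.sqrt m.
Let s0 : 0 < s. Proof. by rewrite sqrtr_gt0. Qed.
Let mE : m = s ^+ 2. Proof. by rewrite sqr_sqrtr// ltW. Qed.

Let iF : (poisson_prob (m * x) 0).-integrable setT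
  (EFin \o (fun k => F (k%:R / m))).
Proof. exact: (integrable_bounded _ (b := 1)). Qed.

Let iF2 : (poisson2 (m * x)).-integrable setT
  (EFin \o (fun z => F ((minn z.1 z.2)%:R / m))).
Proof.
apply: (integrable_bounded _ (b := 1)) => //.
exact: measurable_fun_nat_pair.
Qed.

(** The linear Taylor term has mean zero, so only the remainder, of second moment x/m, is left. *)
Lemma szasz_mean_dist1 : `|szasz_mean m x - F x| <= K1 * x / m.
Proof.
have [ih Ih] := scaled_poisson_moments m0 x0 (F x) (f x) 0 0.
have [ie Ie] := scaled_poisson_moments m0 x0 0 0 K1 0.
rewrite (_ : F x = F x + 0 * (x / m) + 0 * ((3 * x ^+ 2 + x / m) / m ^+ 2));
  last by ring.
rewrite -Ih (le_trans (Rintegral_dist_le iF ih ie _))//.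
  move=> k; rewrite !mul0r !addr0 !add0r.
  by apply: (taylor1 F_continuous dF df f'_le) => //; exact: divr_ge0 (ltW m0).
by rewrite Ie; lra.
Qed.

(** From |F u - F x| <= K0 |t| with t = u - x and |t| <= (1/s + s t^2)/2; the weight s = sqrt m is
    balanced, since t^2 has mean x/m. *)
Lemma szasz_mean_dist0 : `|szasz_mean m x - F x| <= K0 * (1 + x) / s.
Proof.
have [ih Ih] := scaled_poisson_moments m0 x0 (F x) 0 0 0.
have [ie Ie] := scaled_poisson_moments m0 x0 (K0 / s / 2) 0 (K0 * s / 2) 0.
rewrite (_ : F x = F x + 0 * (x / m) + 0 * ((3 * x ^+ 2 + x / m) / m ^+ 2));
  last by ring.
rewrite -Ih (le_trans (Rintegral_dist_le iF ih ie _))//.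
  move=> k; rewrite !mul0r !addr0.
  rewrite (le_trans (taylor0 F_continuous dF f_le x0 (divr_ge0 _ (ltW m0))))//.
  move: (_ - x) => t.
  rewrite [leRHS](_ : _ = K0 * ((s^-1 + s * t ^+ 2) / 2)); last by ring.
  rewrite ler_wpM2l// ler_pdivlMr// -(ler_pM2l s0) [leRHS]mulrDr divff ?gt_eqF//.
  rewrite -real_normK ?num_real//.
  by have := sqr_ge0 (s * `|t| - 1); move: `|t| => u; nra.
rewrite Ie mE [leLHS](_ : _ = K0 * (1 + x) / s / 2); last by field; rewrite gt_eqF.
rewrite ler_pdivrMr// ler_peMr ?ler1n// divr_ge0 ?(ltW s0)// mulr_ge0//.
by rewrite addr_ge0// ltW.
Qed.

Let min_dev_sqr (k l : nat) : ((minn k l)%:R / m - x) ^+ 2 <=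
  (k%:R / m - x) ^+ 2 + (l%:R / m - x) ^+ 2.
Proof. by rewrite /minn; case: ifP => _; rewrite ?lerDl ?lerDr sqr_ge0. Qed.

(** Serves for domination: unlike [szasz_sqr_dist1] it does not blow up as x tends to 0. *)
Lemma szasz_sqr_dist0 : `|szasz_sqr m x - F x| <= K0 * (1 + 2 * x) / s.
Proof.
have [ih Ih] := scaled_poisson2_moments m0 x0 (F x) 0 0 0.
have [ie Ie] := scaled_poisson2_moments m0 x0 (K0 / s / 2) 0 (K0 * s / 2) 0.
rewrite [X in _ - X](_ : F x = F x + 2 * 0 * (x / m) +
  0 * \int[poisson2 (m * x)]_z `|z.1%:R - z.2%:R|); last by ring.
rewrite -Ih (le_trans (Rintegral_dist_le iF2 ih ie _))//.
  move=> [k l] /=; rewrite !mul0r !addr0.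
  rewrite (le_trans (taylor0 F_continuous dF f_le x0 (divr_ge0 _ (ltW m0))))//.
  have := min_dev_sqr k l; move: (_%:R / m - x) => t.
  move: (_ + _ ^+ 2) => q tq.
  rewrite [leRHS](_ : _ = K0 * ((s^-1 + s * q) / 2)); last by ring.
  rewrite ler_wpM2l// ler_pdivlMr// -(ler_pM2l s0) [leRHS]mulrDr divff ?gt_eqF//.
  rewrite -real_normK ?num_real// in tq.
  have : 0 <= s ^+ 2 * (q - `|t| ^+ 2) by rewrite mulr_ge0 ?sqr_ge0// subr_ge0.
  by have := sqr_ge0 (s * `|t| - 1); move: `|t| {tq} => u; nra.
rewrite Ie mE [leLHS](_ : _ = K0 * (1 + 2 * x) / s / 2); last by field; rewrite gt_eqF.
rewrite ler_pdivrMr// ler_peMr ?ler1n// divr_ge0 ?(ltW s0)// mulr_ge0//.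
by rewrite addr_ge0// mulr_ge0// ltW.
Qed.

Lemma szasz_sqr_dist1 :
  `|s * (szasz_sqr m x - F x) + f x * Num.sqrt (x / pi)| <=
  2 * K1 * x / s + K0 * (1 + (s * Num.sqrt (x / pi))^-1) / s.
Proof.
set q := Num.sqrt (x / pi).
set D := \int[poisson2 (m * x)]_z `|z.1%:R - z.2%:R|.
have Dq : `|D - 2 * (s * q)| <= 1 + (s * q)^-1.
  have := Rintegral_poisson2_dist mx0.
  by rewrite -mulrA sqrtrM ?(ltW m0)// -/s -/q.
(* The coefficients spell out f x (min(N, N')/m - x) with min(N, N') = (N + N' - |N - N'|)/2. *)
have [ih Ih] := scaled_poisson2_moments m0 x0 (F x) (f x / 2) 0 (- (f x / (2 * m))).
have [ie Ie] := scaled_poisson2_moments m0 x0 0 0 K1 0.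
have := Rintegral_dist_le iF2 ih ie.
rewrite Ih Ie -/(szasz_sqr m x) -/D => h.
have {}h : `|szasz_sqr m x - F x + f x / (2 * m) * D| <= 2 * K1 * x / m.
  rewrite (_ : _ + _ * D = szasz_sqr m x - (F x + 2 * 0 * (x / m) +
    - (f x / (2 * m)) * D)); last by ring.
  rewrite (_ : 2 * K1 * x / m = 0 + 2 * K1 * (x / m) + 0 * D); last by ring.
  apply: h => -[k l] /=; rewrite !mul0r !add0r !addr0.
  apply: (@le_trans _ _ (K1 * ((minn k l)%:R / m - x) ^+ 2)); last first.
    by rewrite ler_wpM2l.
  rewrite (_ : _ + _ + _ = F x + f x * ((minn k l)%:R / m - x)).
    by apply: (taylor1 F_continuous dF df f'_le) => //; exact: divr_ge0 (ltW m0).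
  have -> : (minn k l)%:R = (k%:R + l%:R - `|k%:R - l%:R|) / 2 :> R.
    rewrite /minn; case: ltnP => kl.
      rewrite ler0_norm; first by field.
      by rewrite subr_le0 ler_nat ltnW.
    rewrite ger0_norm; first by field.
    by rewrite subr_ge0 ler_nat.
  by field; rewrite gt_eqF.
rewrite [X in `|X|](_ : _ = s * (szasz_sqr m x - F x + f x / (2 * m) * D) -
  f x * (D - 2 * (s * q)) / 2 / s); last first.
  by rewrite mE; field; rewrite gt_eqF.
rewrite (le_trans (ler_normB _ _))// lerD//.
  rewrite normrM gtr0_norm//.
  rewrite (le_trans (ler_wpM2l (ltW s0) h))// mE le_eqVlt; apply/orP; left.
  by apply/eqP; field; rewrite gt_eqF.
rewrite !normrM [`|s^-1|]ger0_norm ?invr_ge0 ?(ltW s0)//.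
rewrite ler_wpM2r ?invr_ge0 ?(ltW s0)// [`|2^-1|]ger0_norm//.
apply: (@le_trans _ _ (`|f x| * `|D - 2 * (s * q)|)).
  by rewrite ler_piMr ?mulr_ge0//; lra.
by rewrite ler_pM// f_le.
Qed.

End fixed_m.

Lemma szasz_mean_itv m : 0 < m -> 0 <= szasz_mean m x <= 1.
Proof.
move=> m0; apply/andP; split.
  by apply: Rintegral_ge0 => k _; have /andP[] := F_itv (k%:R / m).
rewrite -[leRHS](Rintegral_probability_cst (poisson_prob (m * x) 0)).
apply: le_Rintegral => //.
- exact: (integrable_bounded _ (b := 1)).
- exact: integrable_probability_cst.
- by move=> k _; have /andP[] := F_itv (k%:R / m).
Qed.

Lemma szasz_bias_le m : 0 < m -> `|m * (szasz_mean m x - F x)| <= K1 * x.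
Proof.
move=> m0; rewrite normrM gtr0_norm// mulrC -ler_pdivlMr//.
exact: szasz_mean_dist1.
Qed.

Lemma szasz_bias_cvg : m * (szasz_mean m x - F x) @[m --> +oo] --> bS f' x.
Proof.
apply: cvg_of_rate => eps eps0.
(* The second moment x/m and the factor [m] turn eps/x into eps. *)
have ex0 : 0 < eps / x by rewrite divr_gt0.
have [K KK0 hK] := taylor2 F_continuous dF df f'_continuous f'_le x0 ex0.
(* The fourth moment times [m] is (3 x^2 + x/m)/m, which for m >= 1 is at most (3 x^2 + x)/sqrt
   m. *)
exists (K * (3 * x ^+ 2 + x)) => m m1.
have m0 : 0 < m by exact: lt_le_trans m1.
have [ih Ih] := scaled_poisson_moments m0 x0 (F x) (f x) (f' x / 2) 0.
have [ie Ie] := scaled_poisson_moments m0 x0 0 0 (eps / x) K.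
have iF : (poisson_prob (m * x) 0).-integrable setT
  (EFin \o (fun k => F (k%:R / m))) by exact: (integrable_bounded _ (b := 1)).
have := Rintegral_dist_le iF ih ie.
rewrite Ih Ie -/(szasz_mean m x) => h.
have {}h : `|szasz_mean m x - F x - f' x / 2 * (x / m)| <=
    eps / m + K * ((3 * x ^+ 2 + x / m) / m ^+ 2).
  rewrite (_ : _ - _ = szasz_mean m x - (F x + f' x / 2 * (x / m) +
    0 * ((3 * x ^+ 2 + x / m) / m ^+ 2))); last by ring.
  rewrite [leRHS](_ : _ = 0 + eps / x * (x / m) +
    K * ((3 * x ^+ 2 + x / m) / m ^+ 2)); last by field; rewrite !gt_eqF.
  apply: h => k; rewrite !mul0r !addr0 !add0r.
  by apply: hK; exact: divr_ge0 (ltW m0).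
rewrite (_ : _ - _ = m * (szasz_mean m x - F x - f' x / 2 * (x / m))); last first.
  by rewrite /bS; field; rewrite gt_eqF.
rewrite normrM gtr0_norm// (le_trans (ler_wpM2l (ltW m0) h))//.
rewrite mulrDr mulrCA divff ?gt_eqF// mulr1 lerD2l.
rewrite [leLHS](_ : _ = K * ((3 * x ^+ 2 + x / m) / m)); last first.
  by field; rewrite gt_eqF.
rewrite -[leRHS]mulrA ler_wpM2l//.
have s0 : 0 < Num.sqrt m by rewrite sqrtr_gt0.
have s1 : 1 <= Num.sqrt m by rewrite -[leLHS]sqrtr1 ler_sqrt ?(ltW m0).
apply: ler_pM; rewrite ?invr_ge0 ?(ltW m0)//.
- by rewrite addr_ge0 ?mulr_ge0 ?sqr_ge0 ?invr_ge0// ltW.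
- by rewrite lerD2l ler_pdivrMr// ler_peMr// ltW.
- rewrite lef_pV2 ?posrelE// -[leRHS](sqr_sqrtr (ltW m0)) expr2.
  by rewrite ler_peMr// ltW.
Qed.

(** Isolates Q - F, which alone contributes at order 1/sqrt m; the product is O(1/m) because S - F
    is. *)
Let varE m : szasz_sqr m x - szasz_mean m x ^+ 2 - sigma2 F x =
  (szasz_sqr m x - F x) - (szasz_mean m x - F x) * (szasz_mean m x + F x).
Proof. by rewrite /sigma2; ring. Qed.

Let szasz_meanD_le m : 0 < m -> `|szasz_mean m x + F x| <= 2.
Proof.
move=> m0; have /andP[a0 a1] := szasz_mean_itv m0.
by have /andP[b0 b1] := F_itv x; rewrite ger0_norm; lra.
Qed.

Lemma szasz_variance_le m : 0 < m ->
  `|Num.sqrt m * (szasz_sqr m x - szasz_mean m x ^+ 2 - sigma2 F x)| <=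
  K0 * (3 + 4 * x).
Proof.
move=> m0; have s0 : 0 < Num.sqrt m by rewrite sqrtr_gt0.
rewrite varE normrM gtr0_norm// mulrC -ler_pdivlMr//.
rewrite (le_trans (ler_normB _ _))// [leRHS](_ : _ =
  K0 * (1 + 2 * x) / Num.sqrt m + K0 * (1 + x) / Num.sqrt m * 2); last by ring.
rewrite lerD ?szasz_sqr_dist0// normrM ler_pM ?szasz_meanD_le//.
exact: szasz_mean_dist0.
Qed.

Lemma szasz_variance_cvg :
  Num.sqrt m * (szasz_sqr m x - szasz_mean m x ^+ 2 - sigma2 F x) @[m --> +oo]
    --> - VS f x.
Proof.
apply: cvg_of_rate => eps eps0.
set q := Num.sqrt (x / pi).
have q0 : 0 < q by rewrite sqrtr_gt0 divr_gt0// pi_gt0.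
exists (2 * K1 * x + K0 * (1 + q^-1) + 2 * K1 * x) => m m1.
have m0 : 0 < m by exact: lt_le_trans m1.
have s0 : 0 < Num.sqrt m by rewrite sqrtr_gt0.
have s1 : 1 <= Num.sqrt m by rewrite -[leLHS]sqrtr1 ler_sqrt ?(ltW m0).
rewrite varE opprK /VS -/q.
have h1 := szasz_sqr_dist1 m0; have h2 := szasz_mean_dist1 m0.
have h3 := szasz_meanD_le m0.
have mE : m = Num.sqrt m ^+ 2 by rewrite sqr_sqrtr// ltW.
rewrite [X in _ / X]mE in h2; rewrite -/q in h1.
move: (szasz_sqr m x) (szasz_mean m x) h1 h2 h3 => Q S.
move: (Num.sqrt m) s0 s1 => s s0 s1 h1 h2 h3.
rewrite (_ : _ + _ = (s * (Q - F x) + f x * q) - s * (S - F x) * (S + F x));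
  last by ring.
rewrite (le_trans (ler_normB _ _))// ler_wpDl ?(ltW eps0)// mulrDl lerD//.
  rewrite (le_trans h1)// -mulrDl ler_wpM2r ?invr_ge0 ?(ltW s0)// lerD2l.
  rewrite ler_wpM2l// lerD2l invfM.
  by rewrite ler_piMl ?invf_le1// invr_ge0 ltW.
rewrite !normrM gtr0_norm//.
have h23 : `|S - F x| * `|S + F x| <= K1 * x / s ^+ 2 * 2 by rewrite ler_pM.
rewrite -mulrA (le_trans (ler_wpM2l (ltW s0) h23))// le_eqVlt; apply/orP; left.
by apply/eqP; field; rewrite gt_eqF.
Qed.

End szasz_pointwise.

(** * Mean squared error for a finite sample *)

Section szasz_kernel.
Context {R : realType}.
Implicit Types (m x y : R).

(* P(N/m >= y) for a Poisson variable N of mean [m x]: what an observation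
   [y] contributes to the estimator at [x]. *)
Definition szasz_kernel m y x : R :=
  fine (\sum_(k <oo) ((y <= k%:R / m)%R%:R * poisson_pmf (m * x) k)%:E)%E.

(** Stated for two functions on one space so as to provide joint measurability on [T * R], which
    Tonelli requires. *)
Lemma measurable_szasz_kernel m (d : measure_display) (T : measurableType d)
    (g h : T -> R) : measurable_fun setT g -> measurable_fun setT h ->
  measurable_fun setT (fun t => szasz_kernel m (g t) (h t)).
Proof.
move=> mg mh; apply: (measurableT_comp (@fine_measurable _ _ measurableT)).
apply: ge0_emeasurable_sum => [k t _ _|k _].
  by rewrite lee_fin mulr_ge0// poisson_pmf_ge0.
apply/measurable_EFinP; apply: measurable_funM.
  exact: measurable_natr_ler.
apply: (measurableT_comp (measurable_poisson_pmf _ measurableT)).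
exact: measurable_funM.
Qed.

Section positive.
Variables (m x : R).
Hypotheses (m0 : 0 < m) (x0 : 0 < x).

Let mx0 : 0 < m * x. Proof. exact: mulr_gt0. Qed.

Lemma szasz_kernelE y : (\int[poisson_prob (m * x) 0]_k
  ((y <= k%:R / m)%R%:R : R)%:E = (szasz_kernel m y x)%:E)%E.
Proof.
rewrite /szasz_kernel -ge0_integral_poisson// fineK//.
apply: integrable_fin_num => //.
apply: (integrable_bounded _ (b := 1)) => // k.
by rewrite ger0_norm// lern1 leq_b1.
Qed.

Lemma szasz_kernel_itv y : 0 <= szasz_kernel m y x <= 1.
Proof.
rewrite -!lee_fin -szasz_kernelE; apply/andP; split.
  by apply: integral_ge0 => k _; rewrite lee_fin.
rewrite -[leRHS](integral_probability_cst (poisson_prob (m * x) 0)).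
by apply: ge0_le_integral => // k _; rewrite ?lee_fin// lern1 leq_b1.
Qed.

Lemma cvg_szasz_kernel y : series (fun k => (y <= k%:R / m)%R%:R *
  szasz_weight k m x) @ \oo --> szasz_kernel m y x.
Proof.
have p0 k : 0 <= (y <= k%:R / m)%R%:R * poisson_pmf (m * x) k.
  by rewrite mulr_ge0// poisson_pmf_ge0.
rewrite (_ : (fun k => _) = fun k => (y <= k%:R / m)%R%:R *
    poisson_pmf (m * x) k); last first.
  by apply/funext => k; rewrite poisson_pmfE.
have : (fun n => \sum_(0 <= k < n) ((y <= k%:R / m)%R%:R *
    poisson_pmf (m * x) k)%:E)%E @ \oo --> (szasz_kernel m y x)%:E.
  rewrite -szasz_kernelE ge0_integral_poisson//.
  by apply: is_cvg_nneseries => k _ _; rewrite lee_fin.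
move=> /fine_cvg; apply: cvg_trans; apply: near_eq_cvg.
by apply: nearW => n; rewrite /= sumEFin.
Qed.

Lemma szasz_estimatorE (T : Type) (X : nat -> T -> R) n w :
  szasz_estimator X m n x w =
  n%:R^-1 * \sum_(i < n) szasz_kernel m (X i w) x.
Proof.
apply/cvg_lim => //.
rewrite (_ : series _ = fun N => n%:R^-1 * \sum_(i < n) series
    (fun k => (X i w <= k%:R / m)%R%:R * szasz_weight k m x) N); last first.
  apply/funext => N; rewrite /series/= exchange_big/= mulr_sumr.
  apply: eq_bigr => k _.
  by rewrite /empirical_cdf -mulrA mulr_suml.
apply: cvgM; first exact: cvg_cst.
apply: cvg_big => [|i _]; first exact: add_continuous.
exact: cvg_szasz_kernel.
Qed.

(** The independent copy of N linearises the product; for [y = y'] it does so for the square. *)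
Lemma szasz_kernelM y y' : ((szasz_kernel m y x * szasz_kernel m y' x)%:E =
  \int[poisson2 (m * x)]_z
    ((y <= z.1%:R / m)%R%:R * (y' <= z.2%:R / m)%R%:R : R)%:E)%E.
Proof.
rewrite /poisson2 fubini_tonelli1//; last exact: measurable_fun_nat_pair.
rewrite /fubini_F/=.
transitivity (\int[poisson_prob (m * x) 0]_k
    ((y <= k%:R / m)%R%:R%:E * (szasz_kernel m y' x)%:E))%E.
  rewrite ge0_integralZr//; first by rewrite szasz_kernelE.
  by rewrite lee_fin; have /andP[] := szasz_kernel_itv y'.
apply: eq_integral => k _; under [RHS]eq_integral do rewrite EFinM.
by rewrite ge0_integralZl_EFin// szasz_kernelE.
Qed.

End positive.
End szasz_kernel.

(** * Moments of the kernel under the law of the sample *)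

Section sample.
Context {R : realType} {d : measure_display} {T : measurableType d}
  {P : probability T R}.
Variables (X : nat -> {RV P >-> R}) (F : R -> R).
Hypothesis X_indep : mutually_independent X.
Hypothesis F_cdf : forall i x, cdf (X i) x = (F x)%:E.

Lemma cdf_itv z : 0 <= F z <= 1.
Proof. by rewrite -!lee_fin -(F_cdf 0) cdf_ge0 cdf_le1. Qed.

Lemma integral_sample_le i s :
  (\int[P]_w ((X i w <= s)%R%:R)%:E = (F s)%:E)%E.
Proof.
rewrite -(F_cdf i) /cdf /distribution/= /pushforward.
rewrite -(setTI (_ @^-1` _)) setIC -integral_indic//; last first.
  exact: measurable_funPTI.
apply: eq_integral => w _; congr EFin; rewrite indicE; congr (nat_of_bool _)%:R.
by apply/idP/idP; rewrite inE/= in_itv.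
Qed.

(** For a single observation the two indicators merge at the smaller threshold; for two observations
    independence is applied to the list [[:: i; j]]. *)
Lemma integral_sample_le2 i j s t :
  (\int[P]_w ((X i w <= s)%R%:R * (X j w <= t)%R%:R)%:E =
   (if i == j then F (Num.min s t) else F s * F t)%:E)%E.
Proof.
have [<-|ij] := eqVneq i j.
  rewrite -(integral_sample_le i); apply: eq_integral => w _; congr EFin.
  by rewrite -natrM mulnb le_min.
have uJ : uniq [:: i; j] by rewrite /= inE ij.
pose A (k : nat) : set R := if k == i then `]-oo, s]%classic else `]-oo, t]%classic.
have mA k : k \in [:: i; j] -> measurable (A k) by rewrite /A; case: ifP.
have := X_indep uJ mA.
rewrite big_cons big_seq1 /A eqxx eq_sym (negbTE ij) => h.
have Fi (k : nat) r : P (X k @^-1` `]-oo, r]) = (F r)%:E by rewrite -(F_cdf k).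
rewrite !Fi -EFinM in h; rewrite -h.
rewrite -(setTI (\bigcap_(_ in _) _)) setIC -integral_indic//; last first.
  by apply: bigcap_measurable => [|k kJ]; [exists i; rewrite /= inE eqxx|
    exact: measurable_funPTI (mA k kJ)].
apply: eq_integral => w _; congr EFin; rewrite indicE -natrM mulnb.
congr (nat_of_bool _)%:R.
apply/andP/idP.
  move=> [Xi Xj]; rewrite inE => k /=; rewrite !inE => /orP[] /eqP ->.
    by rewrite eqxx/= in_itv.
  by rewrite eq_sym (negbTE ij)/= in_itv.
rewrite inE => h'; split.
  by have := h' i; rewrite eqxx/= in_itv/=; apply; rewrite inE eqxx.
by have := h' j; rewrite eq_sym (negbTE ij)/= in_itv/=; apply; rewrite !inE eqxx orbT.
Qed.

Variables (m x : R).
Hypotheses (m0 : 0 < m) (x0 : 0 < x).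

Lemma integral_sample_kernel i :
  (\int[P]_w (szasz_kernel m (X i w) x)%:E = (szasz_mean F m x)%:E)%E.
Proof.
under eq_integral do rewrite -szasz_kernelE//.
rewrite (fubini_tonelli (m1 := P) (m2 := poisson_prob (m * x) 0)
  (fun z => ((X i z.1 <= z.2%:R / m)%R%:R)%:E))//=; last first.
  apply/measurable_EFinP/measurable_natr_ler.
    exact: (measurableT_comp (measurable_funP (X i)) measurable_fst).
  exact: (@measurableT_comp _ _ _ _ _ _ (fun k : nat => k%:R / m)).
under eq_integral do rewrite integral_sample_le.
rewrite /szasz_mean /Rintegral fineK//.
apply: integrable_fin_num => //.
apply: (integrable_bounded _ (b := 1)) => // k.
by have /andP[? ?] := cdf_itv (k%:R / m); rewrite ger0_norm.
Qed.

Lemma integral_sample_kernel2 i j :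
  (\int[P]_w (szasz_kernel m (X i w) x * szasz_kernel m (X j w) x)%:E =
   (if i == j then szasz_sqr F m x else szasz_mean F m x ^+ 2)%:E)%E.
Proof.
under eq_integral do rewrite szasz_kernelM//.
rewrite (fubini_tonelli (m1 := P) (m2 := poisson2 (m * x))
  (fun u => ((X i u.1 <= u.2.1%:R / m)%R%:R *
    (X j u.1 <= u.2.2%:R / m)%R%:R)%:E))//=; last first.
  apply/measurable_EFinP/measurable_funM; apply: measurable_natr_ler.
  + exact: (measurableT_comp (measurable_funP (X i)) measurable_fst).
  + apply: (@measurableT_comp _ _ _ _ _ _
      (fun z : nat * nat => z.1%:R / m)) => //.
    exact: measurable_fun_nat_pair.
  + exact: (measurableT_comp (measurable_funP (X j)) measurable_fst).
  + apply: (@measurableT_comp _ _ _ _ _ _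
      (fun z : nat * nat => z.2%:R / m)) => //.
    exact: measurable_fun_nat_pair.
under eq_integral do rewrite integral_sample_le2.
case: eqVneq => [_|_].
  rewrite /szasz_sqr /Rintegral fineK; last first.
    apply: integrable_fin_num => //.
    apply: (integrable_bounded _ (b := 1)) => [|z].
      exact: measurable_fun_nat_pair.
    by have /andP[? ?] := cdf_itv ((minn z.1 z.2)%:R / m); rewrite ger0_norm.
  apply: eq_integral => z _; congr (F _)%:E.
  rewrite -minr_pMl ?invr_ge0 ?(ltW m0)//; congr (_ / _).
  by rewrite /minn /Num.min ltr_nat; case: ifP.
have iF : (poisson_prob (m * x) 0).-integrable setT
    (EFin \o (fun k => F (k%:R / m))).
  apply: (integrable_bounded _ (b := 1)) => // k.
  by have /andP[? ?] := cdf_itv (k%:R / m); rewrite ger0_norm.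
rewrite /poisson2 fubini_tonelli1//; last 2 first.
- exact: measurable_fun_nat_pair.
- move=> z; rewrite lee_fin mulr_ge0//.
    by have /andP[] := cdf_itv (z.1%:R / m).
  by have /andP[] := cdf_itv (z.2%:R / m).
have FE : (\int[poisson_prob (m * x) 0]_k (F (k%:R / m))%:E =
    (szasz_mean F m x)%:E)%E.
  by rewrite /szasz_mean /Rintegral fineK//; exact: integrable_fin_num.
transitivity (\int[poisson_prob (m * x) 0]_k
    ((F (k%:R / m))%:E * (szasz_mean F m x)%:E))%E; last first.
  by rewrite integralZr// FE.
apply: eq_integral => k _; rewrite /fubini_F/=.
under eq_integral do rewrite EFinM.
by rewrite integralZl// FE.
Qed.

Lemma integral_sample_mse n : (0 < n)%N ->
  (\int[P]_w ((n%:R^-1 * \sum_(i < n) szasz_kernel m (X i w) x - F x) ^+ 2)%:E =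
   (n%:R^-1 * (szasz_sqr F m x - szasz_mean F m x ^+ 2) +
    (szasz_mean F m x - F x) ^+ 2)%:E)%E.
Proof.
move=> n0; set c := F x; set S := szasz_mean F m x; set Q := szasz_sqr F m x.
have nR0 : n%:R != 0 :> R by rewrite pnatr_eq0 -lt0n.
pose K i w := szasz_kernel m (X i w) x.
have mK i : measurable_fun setT (K i).
  by apply: measurable_szasz_kernel => //; exact: measurable_funP (X i).
have K1 i w : `|K i w| <= 1.
  by have /andP[? ?] := szasz_kernel_itv m0 x0 (X i w); rewrite ger0_norm.
have iK i : P.-integrable setT (EFin \o K i) by exact: (integrable_bounded _ (b := 1)).
have iKK i j : P.-integrable setT (EFin \o (fun w => K i w * K j w)).
  apply: (integrable_bounded _ (b := 1)) => [|w]; first exact: measurable_funM.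
  by rewrite normrM -[leRHS]mulr1 ler_pM.
have EK i : \int[P]_w K i w = S by rewrite /Rintegral integral_sample_kernel.
have EKK i j : \int[P]_w (K i w * K j w) = S ^+ 2 + (i == j)%:R * (Q - S ^+ 2).
  rewrite /Rintegral integral_sample_kernel2 /=; case: (i == j).
    by rewrite mulr1n /Q /S; ring.
  by rewrite mulr0n mul0r addr0.
pose b : R := n%:R^-1 ^+ 2.
(* This is b (K i - c)(K j - c), arranged as affine pieces for [Rintegral_affine]. The n^2 pairs
   give (S - c)^2 and the n diagonal ones the excess (Q - S^2)/n. *)
pose t i j w := (b * c ^+ 2 + - (b * c) * K i w) +
  ((0 + - (b * c) * K j w) + (0 + b * (K i w * K j w))).
have i1 i := integrable_affine (b * c ^+ 2) (- (b * c)) (iK i).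
have i2 i := integrable_affine 0 (- (b * c)) (iK i).
have i3 i j := integrable_affine 0 b (iKK i j).
have i23 i j := integrableD_EFin measurableT (i2 j) (i3 i j).
have it i j : P.-integrable setT (EFin \o t i j) by exact: integrableD_EFin.
have Et i j : (\int[P]_w (t i j w)%:E =
    (b * (S - c) ^+ 2 + (i == j)%:R * (b * (Q - S ^+ 2)))%:E)%E.
  rewrite -[LHS]fineK; last exact: (integrable_fin_num measurableT (it i j)).
  congr EFin; rewrite -/(Rintegral P setT (t i j)).
  rewrite (RintegralD _ (i1 i) (i23 i j))// (RintegralD _ (i2 j) (i3 i j))//.
  by rewrite !Rintegral_affine// !EK EKK; ring.
transitivity (\int[P]_w (\sum_(i < n) \sum_(j < n) (t i j w)%:E))%E.
  apply: eq_integral => w _.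
  under [RHS]eq_bigr do rewrite sumEFin.
  rewrite sumEFin; congr EFin.
  have -> : n%:R^-1 * (\sum_(i < n) szasz_kernel m (X i w) x) - c =
      n%:R^-1 * \sum_(i < n) (K i w - c).
    by rewrite sumrB sumr_const card_ord -mulr_natl; field.
  rewrite exprMn [X in _ * X]expr2 mulr_suml mulr_sumr; apply: eq_bigr => i _.
  rewrite mulr_sumr mulr_sumr; apply: eq_bigr => j _.
  by rewrite /t /b; ring.
rewrite integral_sum//; last first.
  by move=> i; apply: integrable_sum => // j _; exact: it.
have Ei (i : 'I_n) : (\int[P]_w \sum_(j < n) (t i j w)%:E =
    \sum_(j < n) (b * (S - c) ^+ 2 + (i == j)%:R * (b * (Q - S ^+ 2)))%:E)%E.
  rewrite integral_sum//; last by move=> j; exact: it.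
  by apply: eq_bigr => j _; exact: Et.
under eq_bigr do rewrite Ei.
under eq_bigr do rewrite sumEFin.
rewrite sumEFin; congr EFin.
under eq_bigr => i _.
  rewrite big_split/= sumr_const card_ord (bigD1 i)//= eqxx mulr1n mul1r.
  rewrite big1 ?addr0; last by move=> j ji; rewrite eq_sym (negbTE ji) mulr0n mul0r.
  over.
rewrite /= sumr_const card_ord -[LHS]mulr_natl -[X in _ * (X + _)]mulr_natl /b.
by field.
Qed.

End sample.

Section szasz_measurable.
Context {R : realType}.
Variables (F : R -> R) (m : R).
Hypotheses (F_itv : forall z, 0 <= F z <= 1) (m0 : 0 < m).

Let F_ge0 z : 0 <= F z. Proof. by have /andP[] := F_itv z. Qed.

Let measurable_pmf k : measurable_fun (`]0, +oo[ : set R)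
  (fun x => poisson_pmf (m * x) k).
Proof.
apply: (measurableT_comp (measurable_poisson_pmf _ measurableT)).
exact: measurable_funM.
Qed.

(** Here the measure itself depends on x; the series form turns this into measurability of each
    [poisson_pmf] in its parameter. *)
Lemma measurable_szasz_mean : measurable_fun (`]0, +oo[ : set R) (szasz_mean F m).
Proof.
apply: (eq_measurable_fun (fun x => fine (\sum_(k <oo)
  (F (k%:R / m) * poisson_pmf (m * x) k)%:E)%E)).
  move=> x; rewrite inE/= in_itv/= andbT => x0.
  by rewrite /szasz_mean /Rintegral ge0_integral_poisson// mulr_gt0.
apply: (measurableT_comp (@fine_measurable _ _ measurableT)).
apply: ge0_emeasurable_sum => [k t _ _|k _].
  by rewrite lee_fin mulr_ge0// poisson_pmf_ge0.
by apply/measurable_EFinP; apply: measurable_funM.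
Qed.

Lemma measurable_szasz_sqr : measurable_fun (`]0, +oo[ : set R) (szasz_sqr F m).
Proof.
apply: (eq_measurable_fun (fun x => fine (\sum_(i <oo) \sum_(j <oo)
  (F ((minn i j)%:R / m) * poisson_pmf (m * x) j * poisson_pmf (m * x) i)%:E)%E)).
  move=> x; rewrite inE/= in_itv/= andbT => x0.
  rewrite /szasz_sqr /Rintegral.
  by rewrite (ge0_integral_poisson2 (h := fun i j => F ((minn i j)%:R / m)))// mulr_gt0.
have h0 i j t : (0 <= (F ((minn i j)%:R / m) * poisson_pmf (m * t) j *
    poisson_pmf (m * t) i)%:E)%E.
  by rewrite lee_fin !mulr_ge0// poisson_pmf_ge0.
apply: (measurableT_comp (@fine_measurable _ _ measurableT)).
apply: ge0_emeasurable_sum => [i t _ _|i _]; first exact: nneseries_ge0.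
apply: ge0_emeasurable_sum => // j _.
by apply/measurable_EFinP; apply: measurable_funM => //; apply: measurable_funM.
Qed.

End szasz_measurable.

(** * The exact bias-variance formula for the MISE *)

Section mise.
Context {R : realType} {d : measure_display} {T : measurableType d}
  {P : probability T R}.
Variables (X : nat -> {RV P >-> R}) (F f : R -> R) (a : R).
Hypothesis X_indep : mutually_independent X.
Hypothesis F_cdf : forall i x, cdf (X i) x = (F x)%:E.
Hypothesis F_continuous : continuous F.
Hypothesis f_ge0 : forall x : R, 0 < x -> 0 <= f x.
Hypothesis f_integrable :
  lebesgue_measure.-integrable `]0, +oo[ (EFin \o f).
Hypothesis a0 : 0 < a.

Let D : set R := `]0, +oo[%classic.
Let mD : measurable D. Proof. exact: measurable_itv. Qed.
Let D0 x : D x -> 0 < x. Proof. by rewrite /D/= in_itv/= andbT. Qed.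

Let phi x := expR (- (a * x)) * f x.

Let phi_ge0 x : D x -> 0 <= phi x.
Proof. by move=> /D0 x0; rewrite mulr_ge0 ?expR_ge0 ?f_ge0. Qed.

Let measurable_phi : measurable_fun D phi.
Proof.
apply: measurable_funM; last by case/integrableP: f_integrable => /measurable_EFinP.
apply: measurable_funTS; apply: measurableT_comp => //.
exact/measurable_funN/measurable_funM.
Qed.

Let measurable_weighted (g : R -> R) : measurable_fun D g ->
  measurable_fun D (fun x => g x * expR (- (a * x)) * f x).
Proof.
move=> mg; apply: (eq_measurable_fun (fun x => g x * phi x)) => [x _|].
  by rewrite /phi mulrA.
exact: measurable_funM.
Qed.

(* The point 0, where the Poisson distribution degenerates and [F] has only a
   one-sided derivative, is left out. *)
Definition weighted_integral_oo (g : R -> R) : R :=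
  \int[lebesgue_measure]_(x in `]0, +oo[) (g x * expR (- (a * x)) * f x).

Lemma integrable_weight (g : R -> R) (C : R) :
  measurable_fun (`]0, +oo[ : set R) g ->
  (forall x, 0 < x -> `|g x| * expR (- (a * x)) <= C) ->
  lebesgue_measure.-integrable `]0, +oo[
    (EFin \o (fun x => g x * expR (- (a * x)) * f x)).
Proof.
move=> mg gC; apply: (@le_integrable _ _ _ lebesgue_measure _ mD _
  (EFin \o (fun x => C * f x))).
- apply/measurable_EFinP.
  exact: measurable_weighted.
- move=> x /D0 x0; rewrite /= lee_fin normrM [leRHS]ger0_norm; last first.
    by rewrite mulr_ge0 ?f_ge0// (le_trans _ (gC _ x0))// mulr_ge0 ?expR_ge0.
  rewrite (ger0_norm (f_ge0 x0)) ler_wpM2r ?f_ge0// normrM.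
  by rewrite [X in _ * X]ger0_norm ?expR_ge0// gC.
- exact: integrableZl_EFin.
Qed.

Lemma weighted_integral_ooE (g : R -> R) : measurable_fun (`]0, +oo[ : set R) g ->
  weighted_integral a f g = weighted_integral_oo g.
Proof.
move=> mg; rewrite /weighted_integral /weighted_integral_oo /Rintegral; congr fine.
rewrite -integral_itv_obnd_cbnd//.
by apply/measurable_EFinP; exact: measurable_weighted.
Qed.

Lemma expR_weight_le1 x : 0 < x -> expR (- (a * x)) <= 1.
Proof. by move=> x0; rewrite -[leRHS]expR0 ler_expR oppr_le0 mulr_ge0// ltW. Qed.

Variables (m : R) (n : nat).
Hypotheses (m0 : 0 < m) (n0 : (0 < n)%N).

Let est w x := n%:R^-1 * \sum_(i < n) szasz_kernel m (X i w) x.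

Let est_itv w x : 0 < x -> 0 <= est w x <= 1.
Proof.
move=> x0; have n0' : 0 < n%:R :> R by rewrite ltr0n.
have k01 i := szasz_kernel_itv m0 x0 (X i w).
rewrite /est; apply/andP; split.
  by rewrite mulr_ge0// sumr_ge0// => i _; have /andP[] := k01 i.
rewrite ler_pdivrMl// mulr1 -[leRHS](_ : \sum_(i < n) (1 : R) = _).
  by apply: ler_sum => i _; have /andP[] := k01 i.
by rewrite sumr_const card_ord.
Qed.

Let F_itv := cdf_itv F_cdf.

Let dist_le1 u v : 0 <= u <= 1 -> 0 <= v <= 1 -> `|u - v| <= 1 :> R.
Proof. by move=> /andP[? ?] /andP[? ?]; rewrite ler_norml; apply/andP; split; lra. Qed.

Let measurable_F : measurable_fun setT F.
Proof. exact: continuous_measurable_fun. Qed.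

(** Tonelli is applied on the whole of [T * R] and needs a nonnegative integrand there, whereas [f]
    has a known sign only on the half-line. *)
Let phiD := phi \_ D.

Let phiD_ge0 x : 0 <= phiD x.
Proof. by rewrite /phiD patchE; case: ifPn => // /set_mem; exact: phi_ge0. Qed.

Let H (u : T * R) : R := (est u.1 u.2 - F u.2) ^+ 2 * phiD u.2.

Let measurable_est : measurable_fun setT (fun u : T * R => est u.1 u.2).
Proof.
apply: measurable_funM => //; apply: measurable_sum => i.
apply: measurable_szasz_kernel; last exact: measurable_snd.
exact: (measurableT_comp (measurable_funP (X i)) measurable_fst).
Qed.

Let measurable_H : measurable_fun setT H.
Proof.
apply: measurable_funM.
  apply: measurable_funX; apply: measurable_funB; first exact: measurable_est.
  exact: (measurableT_comp measurable_F measurable_snd).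
apply: (measurableT_comp _ measurable_snd).
exact/(measurable_restrictT _ mD).
Qed.

(** The inner integral of [MISE] is a real number obtained through [fine]; integrability shows that
    nothing is lost, which gives Tonelli an extended-real integral to work on. *)
Lemma ISE_kernel w :
  (\int[lebesgue_measure]_(x in `[0, +oo[) ((szasz_estimator X m n x w - F x) ^+ 2
     * expR (- (a * x)) * f x))%:E = (\int[lebesgue_measure]_x (H (w, x))%:E)%E.
Proof.
have me : measurable_fun (`]0, +oo[ : set R) (fun x => (est w x - F x) ^+ 2).
  apply: measurable_funTS; apply: measurable_funX; apply: measurable_funB => //.
  exact: (measurableT_comp measurable_est (measurable_pair1 w)).
have ie : lebesgue_measure.-integrable `]0, +oo[ (EFin \o
    (fun x => (est w x - F x) ^+ 2 * expR (- (a * x)) * f x)).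
  apply: (integrable_weight (C := 1)) => // x x0.
  rewrite -[leRHS]mulr1 ler_pM ?expR_ge0 ?expR_weight_le1//.
  by rewrite normrX exprn_ile1// dist_le1// est_itv.
have estE x : 0 < x -> szasz_estimator X m n x w = est w x.
  by move=> x0; rewrite szasz_estimatorE.
rewrite /Rintegral -integral_itv_obnd_cbnd; last first.
  case/integrableP: ie => + _; apply: eq_measurable_fun => x /set_mem/D0 x0.
  by rewrite /= estE.
under eq_integral => x /set_mem/D0 x0 do rewrite estE//.
rewrite fineK; last by apply: integrable_fin_num => //; exact: ie.
rewrite integral_mkcond; apply: eq_integral => x _.
rewrite /H /phiD !patchE /=; case: ifPn => _; last by rewrite mulr0.
by rewrite /phi mulrA.
Qed.

Let QS_le1 x : 0 < x -> `|szasz_sqr F m x - szasz_mean F m x ^+ 2| <= 1.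
Proof.
move=> x0; have /andP[S0 S1] := szasz_mean_itv F_itv x m0.
apply: dist_le1; last by rewrite exprn_ge0// exprn_ile1.
apply/andP; split.
  by apply: Rintegral_ge0 => z _; have /andP[] := F_itv ((minn z.1 z.2)%:R / m).
rewrite -[leRHS](Rintegral_probability_cst (poisson2 (m * x))).
apply: le_Rintegral => //.
- apply: (integrable_bounded _ (b := 1)) => [|z].
    exact: measurable_fun_nat_pair.
  by have /andP[? ?] := F_itv ((minn z.1 z.2)%:R / m); rewrite ger0_norm.
- exact: integrable_probability_cst.
- by move=> z _; have /andP[] := F_itv ((minn z.1 z.2)%:R / m).
Qed.

Let measurable_QS : measurable_fun (`]0, +oo[ : set R)
  (fun x => szasz_sqr F m x - szasz_mean F m x ^+ 2).
Proof.
apply: measurable_funB; first exact: measurable_szasz_sqr.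
by apply: measurable_funX; exact: measurable_szasz_mean.
Qed.

Let measurable_bias2 : measurable_fun (`]0, +oo[ : set R)
  (fun x => (szasz_mean F m x - F x) ^+ 2).
Proof.
apply: measurable_funX; apply: measurable_funB; first exact: measurable_szasz_mean.
exact: measurable_funTS.
Qed.

Lemma MISE_bias_variance : MISE X F f a m n =
  (n%:R^-1 *
     weighted_integral_oo (fun x => szasz_sqr F m x - szasz_mean F m x ^+ 2) +
   weighted_integral_oo (fun x => (szasz_mean F m x - F x) ^+ 2))%:E.
Proof.
rewrite /MISE expectation.unlock.
under eq_integral do rewrite ISE_kernel.
rewrite (fubini_tonelli (m1 := P) (m2 := lebesgue_measure)
  (fun u => (H u)%:E))/=; last 2 first.
- exact/measurable_EFinP.
- by move=> u; rewrite lee_fin mulr_ge0// sqr_ge0.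
pose A x := (szasz_sqr F m x - szasz_mean F m x ^+ 2) * expR (- (a * x)) * f x.
pose B x := (szasz_mean F m x - F x) ^+ 2 * expR (- (a * x)) * f x.
have iA : lebesgue_measure.-integrable `]0, +oo[ (EFin \o A).
  apply: (integrable_weight (C := 1)) => // x x0.
  by rewrite -[leRHS]mulr1 ler_pM ?expR_ge0 ?expR_weight_le1// QS_le1.
have iB : lebesgue_measure.-integrable `]0, +oo[ (EFin \o B).
  apply: (integrable_weight (C := 1)) => // x x0.
  rewrite -[leRHS]mulr1 ler_pM ?expR_ge0 ?expR_weight_le1//.
  by rewrite normrX exprn_ile1// dist_le1// szasz_mean_itv.
have inA : lebesgue_measure.-integrable `]0, +oo[
    (EFin \o (fun x => n%:R^-1 * A x)) by exact: integrableZl_EFin.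
transitivity (\int[lebesgue_measure]_(x in `]0%R, +oo[)
    (n%:R^-1 * A x + B x)%:E)%E; last first.
  rewrite -[LHS]fineK; last first.
    by apply: integrable_fin_num => //; exact: integrableD_EFin.
  congr EFin.
  rewrite [LHS](_ : _ = \int[lebesgue_measure]_(x in `]0, +oo[)
    (n%:R^-1 * A x + B x))//.
  by rewrite (RintegralD _ inA iB)// RintegralZl.
rewrite [RHS]integral_mkcond; apply: eq_integral => x _.
rewrite patchE; case: ifPn => [/set_mem xD|xD]; last first.
  rewrite integral0_eq// => w _.
  by rewrite /H /phiD patchE (negbTE xD) mulr0.
have x0 := D0 xD.
under [LHS]eq_integral do rewrite /H EFinM/=.
rewrite ge0_integralZr//; last 3 first.
- apply/measurable_EFinP/measurable_funX; apply: measurable_funB => //.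
  exact: (measurableT_comp measurable_est (measurable_pair2 x)).
- by move=> w _; rewrite lee_fin sqr_ge0.
- by rewrite lee_fin.
rewrite (integral_sample_mse X_indep F_cdf m0 x0 n0) -EFinM; congr EFin.
by rewrite /phiD patchE mem_set// /A /B /phi; ring.
Qed.

End mise.

(** * Asymptotic expansion of the MISE *)

(** From exp(bx) >= 1 + bx, with b = a for the first bound and b = a/2, squared, for the second. *)
Lemma expR_sqr_le (R : realType) (a x : R) : 0 < a -> 0 < x ->
  x * expR (- (a * x)) <= a^-1 /\ x ^+ 2 * expR (- (a * x)) <= 4 / a ^+ 2.
Proof.
move=> a0 x0.
have h (b : R) : 0 < b -> x * expR (- (b * x)) <= b^-1.
  move=> b0; rewrite expRN ler_pdivrMr ?expR_gt0// ler_pdivlMl//.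
  by rewrite (le_trans _ (expR_ge1Dx _))// lerDr.
split; first exact: h.
have a20 : 0 < a / 2 by rewrite divr_gt0.
have h2 := h _ a20.
rewrite (_ : - (a * x) = - (a / 2 * x) + - (a / 2 * x)); last by field.
rewrite expRD [leLHS](_ : _ = (x * expR (- (a / 2 * x))) ^+ 2); last by ring.
rewrite [leRHS](_ : _ = (a / 2)^-1 ^+ 2); last by field; rewrite gt_eqF.
by rewrite lerXn2r// ?nnegrE ?mulr_ge0 ?expR_ge0 ?invr_ge0// ltW.
Qed.

Section weighted_integral_theory.
Context {R : realType}.
Variables (f : R -> R) (a : R).
Hypothesis f_ge0 : forall x : R, 0 < x -> 0 <= f x.
Hypothesis f_integrable :
  lebesgue_measure.-integrable `]0, +oo[ (EFin \o f).

Local Notation Df g := (fun x => g x * expR (- (a * x)) * f x).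

Lemma weighted_integral_ooZ (c : R) (g : R -> R) :
  lebesgue_measure.-integrable `]0, +oo[ (EFin \o Df g) ->
  weighted_integral_oo f a (fun x => c * g x) = c * weighted_integral_oo f a g.
Proof.
move=> ig; rewrite /weighted_integral_oo -RintegralZl//.
by apply: eq_Rintegral => x _; rewrite !mulrA.
Qed.

Lemma weighted_integral_ooB (g h : R -> R) :
  lebesgue_measure.-integrable `]0, +oo[ (EFin \o Df g) ->
  lebesgue_measure.-integrable `]0, +oo[ (EFin \o Df h) ->
  weighted_integral_oo f a (fun x => g x - h x) =
  weighted_integral_oo f a g - weighted_integral_oo f a h.
Proof.
move=> ig ih; rewrite /weighted_integral_oo -RintegralB//.
by apply: eq_Rintegral => x _; rewrite !mulrBl.
Qed.

Lemma cvg_weighted_integral_oo (G : R -> R -> R) (L : R -> R) (C : R) :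
  (forall m, 0 < m -> measurable_fun (`]0, +oo[ : set R) (G m)) ->
  measurable_fun (`]0, +oo[ : set R) L ->
  (forall x, 0 < x -> G m x @[m --> +oo] --> L x) ->
  (forall m x, 0 < m -> 0 < x -> `|G m x| * expR (- (a * x)) <= C) ->
  weighted_integral_oo f a (G m) @[m --> +oo] --> weighted_integral_oo f a L.
Proof.
move=> mG mL GL GC.
(* Dominated convergence is applied along an arbitrary sequence tending to +oo, whose first terms
   may be negative; the truncation makes the bounds hold for every term. *)
pose G' (m : R) := G (Num.max m 1).
have G'E : \forall m \near +oo, G' m = G m.
  near=> m; rewrite /G' max_l//; near: m; exact: nbhs_pinfty_ge.
have m1 (m : R) : 0 < Num.max m 1 by rewrite lt_max ltr01 orbT.
suff : weighted_integral_oo f a (G' m) @[m --> +oo] --> weighted_integral_oo f a L.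
  apply: cvg_trans; apply: near_eq_cvg.
  by apply: filterS G'E => m ->.
apply/cvg_pinftyP => u uoo.
have iG' n : lebesgue_measure.-integrable `]0, +oo[ (EFin \o Df (G' (u n))).
  apply: (integrable_weight f_ge0 f_integrable (C := C)).
    exact: mG.
  by move=> x x0; exact: GC.
have mDf n : measurable_fun (`]0, +oo[ : set R) (EFin \o Df (G' (u n))).
  by case/integrableP: (iG' n).
have D0 (x : R) : `]0, +oo[%classic x -> 0 < x by rewrite /= in_itv/= andbT.
have mDL : measurable_fun (`]0, +oo[ : set R) (EFin \o Df L).
  apply/measurable_EFinP; apply: measurable_funM; last first.
    by case/integrableP: f_integrable => /measurable_EFinP.
  apply: measurable_funM => //; apply: measurable_funTS.
  by apply: measurableT_comp => //; exact/measurable_funN/measurable_funM.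
have icf : lebesgue_measure.-integrable `]0, +oo[ (EFin \o (fun x => C * f x)).
  exact: integrableZl_EFin.
have Gcvg x : 0 < x -> Df (G' (u n)) x @[n --> \oo] --> Df L x.
  move=> x0; apply: cvgM; last exact: cvg_cst.
  apply: cvgM; last exact: cvg_cst.
  have := GL x x0 => /cvg_pinftyP/(_ u uoo); apply: cvg_trans.
  apply: near_eq_cvg; have /cvgryPge/(_ 1) := uoo; apply: filterS => n un.
  by rewrite /G' max_l.
have [||iL _ hcvg] := dominated_convergence (mu := lebesgue_measure)
   (D := `]0, +oo[%classic) (measurable_itv _) mDf mDL _ icf.
- by apply: aeW => x /D0 x0; apply: cvg_EFin; [exact: nearW|exact: Gcvg].
- apply: aeW => x n /D0 x0; rewrite /= lee_fin normrM (ger0_norm (f_ge0 x0)).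
  by rewrite ler_wpM2r ?f_ge0// normrM (ger0_norm (expR_ge0 _)) GC.
have /= := hcvg.
rewrite /weighted_integral_oo /Rintegral => h; apply: fine_cvg.
by rewrite fineK//; apply: (integrable_fin_num _ iL); exact: measurable_itv.
Unshelve. all: by end_near. Qed.

End weighted_integral_theory.

Section expansion.
Context {R : realType} {d : measure_display} {T : measurableType d}
  {P : probability T R}.
Variables (X : nat -> {RV P >-> R}) (F f f' : R -> R) (a K0 K1 : R).
Hypothesis X_indep : mutually_independent X.
Hypothesis F_cdf : forall i x, cdf (X i) x = (F x)%:E.
Hypothesis F_continuous : continuous F.
Hypothesis dF : forall z : R, 0 < z -> is_derive z 1 F (f z).
Hypothesis df : forall z : R, 0 < z -> is_derive z 1 f (f' z).
Hypothesis f'_continuous : forall z : R, 0 < z -> {for z, continuous f'}.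
Hypothesis f_le : forall z : R, 0 < z -> `|f z| <= K0.
Hypothesis f'_le : forall z : R, 0 < z -> `|f' z| <= K1.
Hypothesis f_ge0 : forall x : R, 0 < x -> 0 <= f x.
Hypothesis f_integrable :
  lebesgue_measure.-integrable `]0, +oo[ (EFin \o f).
Hypothesis a0 : 0 < a.

Let F_itv := cdf_itv F_cdf.

Let K00 : 0 <= K0. Proof. by rewrite (le_trans _ (f_le ltr01)). Qed.
Let K10 : 0 <= K1. Proof. by rewrite (le_trans _ (f'_le ltr01)). Qed.

Let measurable_F : measurable_fun (`]0, +oo[ : set R) F.
Proof. by apply: measurable_funTS; exact: continuous_measurable_fun. Qed.

Let measurable_f : measurable_fun (`]0, +oo[ : set R) f.
Proof. by case/integrableP: f_integrable => /measurable_EFinP. Qed.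

Let measurable_f' : measurable_fun (`]0, +oo[ : set R) f'.
Proof.
apply: open_continuous_measurable_fun; first exact: interval_open.
by move=> x; rewrite inE/= in_itv/= andbT; exact: f'_continuous.
Qed.

Lemma measurable_sigma2 : measurable_fun (`]0, +oo[ : set R) (sigma2 F).
Proof. by apply: measurable_funM => //; exact: measurable_funB. Qed.

Lemma measurable_VS : measurable_fun (`]0, +oo[ : set R) (VS f).
Proof.
have msqrt : measurable_fun setT (Num.sqrt : R -> R).
  by apply: continuous_measurable_fun; exact: sqrt_continuous.
apply: measurable_funM => //; apply: (measurableT_comp msqrt).
exact: measurable_funM.
Qed.

Lemma measurable_bS2 : measurable_fun (`]0, +oo[ : set R) (fun x => bS f' x ^+ 2).
Proof.
apply: measurable_funX; apply: measurable_funM => //.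
exact: measurable_funM.
Qed.

Lemma integrable_sigma2 : lebesgue_measure.-integrable `]0, +oo[
  (EFin \o (fun x => sigma2 F x * expR (- (a * x)) * f x)).
Proof.
apply: (integrable_weight f_ge0 f_integrable (C := 1)).
  exact: measurable_sigma2.
move=> x x0; rewrite -[leRHS]mulr1 ler_pM ?expR_ge0 ?expR_weight_le1//.
have /andP[F0 F1] := F_itv x.
by rewrite normrM !ger0_norm ?subr_ge0// mulr_ile1 ?subr_ge0// gerBl.
Qed.

Let variance (m x : R) := szasz_sqr F m x - szasz_mean F m x ^+ 2.
Let bias2 (m x : R) := (szasz_mean F m x - F x) ^+ 2.

Let measurable_variance m : 0 < m ->
  measurable_fun (`]0, +oo[ : set R) (variance m).
Proof.
move=> m0; apply: measurable_funB; first exact: measurable_szasz_sqr.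
by apply: measurable_funX; exact: measurable_szasz_mean.
Qed.

Let measurable_bias2 m : 0 < m -> measurable_fun (`]0, +oo[ : set R) (bias2 m).
Proof.
move=> m0; apply: measurable_funX; apply: measurable_funB => //.
exact: measurable_szasz_mean.
Qed.

Lemma bias_bound (m x : R) : 0 < m -> 0 < x ->
  `|m ^+ 2 * bias2 m x| * expR (- (a * x)) <= K1 ^+ 2 * (4 / a ^+ 2).
Proof.
move=> m0 x0; have [_ h] := expR_sqr_le a0 x0.
rewrite /bias2 -exprMn normrX.
apply: (@le_trans _ _ ((K1 * x) ^+ 2 * expR (- (a * x)))).
  rewrite ler_wpM2r ?expR_ge0// lerXn2r ?nnegrE ?mulr_ge0 ?(ltW x0)//.
  exact: (szasz_bias_le F_continuous F_itv dF df f'_le x0 m0).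
by rewrite exprMn -mulrA ler_wpM2l// sqr_ge0.
Qed.

Lemma variance_bound (m x : R) : 0 < m -> 0 < x ->
  `|Num.sqrt m * (variance m x - sigma2 F x)| * expR (- (a * x)) <=
  K0 * (3 + 4 * a^-1).
Proof.
move=> m0 x0; have [h _] := expR_sqr_le a0 x0.
apply: (@le_trans _ _ (K0 * (3 + 4 * x) * expR (- (a * x)))).
  rewrite ler_wpM2r ?expR_ge0//.
  exact: (szasz_variance_le F_continuous F_itv dF f_le x0 m0).
rewrite -mulrA ler_wpM2l// mulrDl lerD//; last by rewrite -mulrA ler_wpM2l.
by rewrite ler_piMr// expR_weight_le1.
Qed.

Lemma integrable_variance m : 0 < m -> lebesgue_measure.-integrable `]0, +oo[
  (EFin \o (fun x => variance m x * expR (- (a * x)) * f x)).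
Proof.
move=> m0; have s0 : 0 < Num.sqrt m by rewrite sqrtr_gt0.
apply: (integrable_weight f_ge0 f_integrable
  (C := (Num.sqrt m)^-1 * (K0 * (3 + 4 * a^-1)) + 1)).
  exact: measurable_variance.
move=> x x0.
apply: (@le_trans _ _ (`|variance m x - sigma2 F x| * expR (- (a * x)) +
    `|sigma2 F x| * expR (- (a * x)))).
  rewrite -mulrDl ler_wpM2r ?expR_ge0//.
  by rewrite -{1}(subrK (sigma2 F x) (variance m x)) ler_normD.
apply: lerD.
  rewrite ler_pdivlMl//.
  have := variance_bound m0 x0.
  by rewrite normrM (gtr0_norm s0) mulrA.
have /andP[F0 F1] := F_itv x.
rewrite -[leRHS]mulr1 ler_pM ?expR_ge0 ?expR_weight_le1//.
by rewrite normrM !ger0_norm ?subr_ge0// mulr_ile1 ?subr_ge0// gerBl.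
Qed.

Lemma integrable_bias2 m : 0 < m -> lebesgue_measure.-integrable `]0, +oo[
  (EFin \o (fun x => bias2 m x * expR (- (a * x)) * f x)).
Proof.
move=> m0.
apply: (integrable_weight f_ge0 f_integrable
  (C := (m ^+ 2)^-1 * (K1 ^+ 2 * (4 / a ^+ 2)))).
  exact: measurable_bias2.
move=> x x0; rewrite ler_pdivlMl ?exprn_gt0//.
rewrite mulrA -[X in X * `|_|](gtr0_norm (exprn_gt0 2 m0)) -normrM.
exact: bias_bound.
Qed.

Lemma integrable_weightZ (c : R) (g : R -> R) :
  lebesgue_measure.-integrable `]0, +oo[
    (EFin \o (fun x => g x * expR (- (a * x)) * f x)) ->
  lebesgue_measure.-integrable `]0, +oo[
    (EFin \o (fun x => c * g x * expR (- (a * x)) * f x)).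
Proof.
move=> ig; rewrite (_ : (fun x => c * g x * _ * _) =
  fun x => c * (g x * expR (- (a * x)) * f x)); first exact: integrableZl_EFin.
by apply/funext => x; rewrite !mulrA.
Qed.

Lemma integrable_variance_dist m : 0 < m ->
  lebesgue_measure.-integrable `]0, +oo[ (EFin \o
    (fun x => (sigma2 F x - variance m x) * expR (- (a * x)) * f x)).
Proof.
move=> m0; rewrite (_ : (fun x => (sigma2 F x - _) * _ * _) =
  fun x => sigma2 F x * expR (- (a * x)) * f x +
    (-1 * variance m x) * expR (- (a * x)) * f x); last first.
  by apply/funext => x; ring.
apply: integrableD_EFin => //; first exact: integrable_sigma2.
by apply: integrable_weightZ; exact: integrable_variance.
Qed.

Lemma variance_expansion :
  Num.sqrt m * (C1S a F f - weighted_integral_oo f a (variance m)) @[m --> +oo] -->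
  C2S a f.
Proof.
have C1E : C1S a F f = weighted_integral_oo f a (sigma2 F).
  by apply: weighted_integral_ooE => //; exact: measurable_sigma2.
have C2E : C2S a f = weighted_integral_oo f a (VS f).
  by apply: weighted_integral_ooE => //; exact: measurable_VS.
rewrite C1E C2E.
have : weighted_integral_oo f a (fun x => Num.sqrt m * (sigma2 F x - variance m x))
    @[m --> +oo] --> weighted_integral_oo f a (VS f).
  apply: (cvg_weighted_integral_oo f_ge0 f_integrable (C := K0 * (3 + 4 * a^-1))).
  - move=> m m0; apply: measurable_funM => //; apply: measurable_funB.
      exact: measurable_sigma2.
    exact: measurable_variance.
  - exact: measurable_VS.
  - move=> x x0.
    have := szasz_variance_cvg F_continuous F_itv dF df f_le f'_le x0.
    move=> /cvgN; rewrite opprK; apply: cvg_trans; apply: near_eq_cvg.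
    by apply: nearW => m /=; rewrite -mulrN opprB.
  - move=> m x m0 x0; rewrite -normrN -mulrN opprB.
    exact: variance_bound.
apply: cvg_trans; apply: near_eq_cvg; near=> m.
have m0 : 0 < m by near: m; exact: nbhs_pinfty_gt.
rewrite (weighted_integral_ooZ _ (integrable_variance_dist m0)).
by rewrite (weighted_integral_ooB integrable_sigma2 (integrable_variance m0)).
Unshelve. all: by end_near. Qed.

Lemma bias_expansion :
  m ^+ 2 * weighted_integral_oo f a (bias2 m) @[m --> +oo] --> C3S a f f'.
Proof.
have C3E : C3S a f f' = weighted_integral_oo f a (fun x => bS f' x ^+ 2).
  by apply: weighted_integral_ooE => //; exact: measurable_bS2.
rewrite C3E.
have : weighted_integral_oo f a (fun x => m ^+ 2 * bias2 m x)
    @[m --> +oo] --> weighted_integral_oo f a (fun x => bS f' x ^+ 2).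
  apply: (cvg_weighted_integral_oo f_ge0 f_integrable (C := K1 ^+ 2 * (4 / a ^+ 2))).
  - by move=> m m0; apply: measurable_funM => //; exact: measurable_bias2.
  - exact: measurable_bS2.
  - move=> x x0.
    have h := szasz_bias_cvg F_continuous F_itv dF df f'_continuous f'_le x0.
    rewrite expr2; apply: cvg_trans (cvgM h h); apply: near_eq_cvg.
    by apply: nearW => m /=; rewrite /bias2; ring.
  - by move=> m x m0 x0; exact: bias_bound.
apply: cvg_trans; apply: near_eq_cvg; near=> m.
have m0 : 0 < m by near: m; exact: nbhs_pinfty_gt.
by rewrite weighted_integral_ooZ//; exact: integrable_bias2.
Unshelve. all: by end_near. Qed.

Lemma MISE_asymptotic_expansion :
  asymptotic_expansion (MISE X F f a) (C1S a F f) (C2S a f) (C3S a f f').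
Proof.
(* The MISE formula being exact, the remainders are defined by subtraction. Divided by their scales
   they no longer depend on n, so the joint limit reduces to one in m. *)
pose r1 (p : R * nat) := p.2%:R^-1 *
  (weighted_integral_oo f a (variance p.1) - C1S a F f + p.1 `^ (- (1 / 2)) * C2S a f).
pose r2 (p : R * nat) :=
  weighted_integral_oo f a (bias2 p.1) - p.1 `^ (- 2) * C3S a f f'.
exists r1, r2; split; last first.
- move=> m n m0 n0.
  rewrite (MISE_bias_variance X_indep F_cdf F_continuous f_ge0 f_integrable a0 m0 n0).
  by congr EFin; rewrite /leading_part /r1 /r2 -/(variance m) -/(bias2 m) /=; ring.
- rewrite /is_littleo.
  pose e m := `|m ^+ 2 * weighted_integral_oo f a (bias2 m) - C3S a f f'|.
  have h : e m @[m --> +oo] --> 0.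
    rewrite -(normr0 R) -(subrr (C3S a f f')).
    by apply: cvg_norm; apply: cvgB; [exact: bias_expansion|exact: cvg_cst].
  have {}h : e p.1 @[p --> filter_prod (pinfty_nbhs R) \oo] --> 0.
    by apply: cvg_comp h; exact: cvg_fst.
  apply: cvg_trans h; apply: near_eq_cvg.
  have : \forall p \near filter_prod (pinfty_nbhs R) \oo, 0 < p.1.
    exists ([set m | 0 < m], setT) => [|p []//].
    by split; [exact: nbhs_pinfty_gt|exact: filterT].
  apply: filterS => -[m n] /= m0; rewrite /r2 /=.
  rewrite powRN (powR_mulrn 2) ?(ltW m0)// invrK; congr (`|_|).
  by field; rewrite gt_eqF.
- rewrite /is_littleo.
  pose e m :=
    `|C2S a f - Num.sqrt m * (C1S a F f - weighted_integral_oo f a (variance m))|.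
  have h : e m @[m --> +oo] --> 0.
    rewrite -(normr0 R) -(subrr (C2S a f)).
    by apply: cvg_norm; apply: cvgB; [exact: cvg_cst|exact: variance_expansion].
  have {}h : e p.1 @[p --> filter_prod (pinfty_nbhs R) \oo] --> 0.
    by apply: cvg_comp h; exact: cvg_fst.
  apply: cvg_trans h; apply: near_eq_cvg.
  have : \forall p \near filter_prod (pinfty_nbhs R) \oo, 0 < p.1 /\ (0 < p.2)%N.
    exists ([set m | 0 < m], [set n | (0 < n)%N]) => //.
    by split; [exact: nbhs_pinfty_gt|exact: nbhs_infty_gt].
  apply: filterS => -[m n] /= [m0 n0]; rewrite /r1 /=.
  have s0 : 0 < Num.sqrt m by rewrite sqrtr_gt0.
  rewrite powRN div1r powR12_sqrt ?(ltW m0)//; congr (`|_|).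
  have n_neq0 : n%:R != 0 :> R by rewrite pnatr_eq0 -lt0n.
  by field; rewrite n_neq0 gt_eqF.
Qed.

End expansion.

(** * Optimal smoothing parameter *)

Section optimum.
Context {R : realType}.
Variables (C1 C2 C3 : R).
Hypotheses (C20 : 0 < C2) (C30 : 0 < C3).

Let t (m : R) : R := m `^ (- (1 / 2)).

Let t_gt0 m : 0 < m -> 0 < t m. Proof. exact: powR_gt0. Qed.

Let powRN2 m : 0 < m -> m `^ (- 2) = t m ^+ 4.
Proof.
by move=> m0; rewrite -powR_mulrn ?powR_ge0// -powRrM; congr (_ `^ _); field.
Qed.

Let t_inj m m' : 0 < m -> 0 < m' -> t m = t m' -> m = m'.
Proof.
have tK (u : R) : 0 < u -> t u `^ (- 2) = u.
  move=> u0; rewrite -powRrM (_ : - (1 / 2) * - 2 = 1); last by field.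
  by rewrite powRr1// ltW.
by move=> m0 m'0 e; rewrite -(tK m m0) e tK.
Qed.

Lemma m_opt_gt0 n : (0 < n)%N -> 0 < m_opt C2 C3 n.
Proof. by move=> n0; rewrite mulr_gt0// powR_gt0 ?ltr0n// divr_gt0// mulr_gt0. Qed.

(** In the variable t = m^(-1/2) the minimiser is n^(-1/3) [kappa]. *)
Definition kappa : R := (C2 / (4 * C3)) `^ (1 / 3).

Let kappaN : kappa = (4 * C3 / C2) `^ (- (1 / 3)).
Proof.
have q0 : 0 <= 4 * C3 / C2 by rewrite divr_ge0 ?mulr_ge0// ltW.
rewrite /kappa -invf_div -[X in X `^ _ = _]powR_inv1// -powRrM.
by congr (_ `^ _); field.
Qed.

Lemma powR_m_opt n : (0 < n)%N ->
  m_opt C2 C3 n `^ (- (1 / 2)) = n%:R `^ (- (1 / 3)) * kappa.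
Proof.
move=> n0; rewrite /m_opt powRM ?powR_ge0// -!powRrM kappaN.
by congr (_ `^ _ * _ `^ _); field.
Qed.

Lemma kappa_gt0 : 0 < kappa.
Proof. by rewrite powR_gt0// divr_gt0// mulr_gt0. Qed.

Lemma kappa3 : kappa ^+ 3 = C2 / (4 * C3).
Proof.
rewrite -powR_mulrn ?powR_ge0// -powRrM (_ : 1 / 3 * 3 = 1); last by field.
by rewrite powRr1// divr_ge0 ?mulr_ge0// ltW.
Qed.

Let nthird n : (0 < n)%N -> n%:R `^ (- (1 / 3)) ^+ 3 = n%:R^-1 :> R.
Proof.
move=> n0; rewrite -powR_mulrn ?powR_ge0// -powRrM.
by rewrite (_ : - (1 / 3) * 3 = -1) ?powR_inv1//; field.
Qed.

(** The stationarity equation of C3 t^4 - n^-1 C2 t. Substituting it turns the comparison of leading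
    parts into a polynomial identity. *)
Let t3 n : (0 < n)%N -> n%:R^-1 * C2 = 4 * C3 * t (m_opt C2 C3 n) ^+ 3.
Proof.
move=> n0; rewrite /t powR_m_opt// exprMn nthird// kappa3.
have n_neq0 : n%:R != 0 :> R by rewrite pnatr_eq0 -lt0n.
by field; rewrite gt_eqF.
Qed.

Lemma leading_part_dist n m : (0 < n)%N -> 0 < m ->
  leading_part C1 C2 C3 m n - leading_part C1 C2 C3 (m_opt C2 C3 n) n =
  C3 * (t m - t (m_opt C2 C3 n)) ^+ 2 *
  (t m ^+ 2 + 2 * t m * t (m_opt C2 C3 n) + 3 * t (m_opt C2 C3 n) ^+ 2).
Proof.
move=> n0 m0; have mo := m_opt_gt0 n0.
rewrite /leading_part !powRN2// -/(t m) -/(t (m_opt C2 C3 n)) -!(mulrA _ _ C2).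
by rewrite t3//; ring.
Qed.

Lemma leading_part_min n m : (0 < n)%N -> 0 < m ->
  leading_part C1 C2 C3 (m_opt C2 C3 n) n <= leading_part C1 C2 C3 m n.
Proof.
move=> n0 m0; have mo := m_opt_gt0 n0.
rewrite -subr_ge0 leading_part_dist//.
have u0 := t_gt0 m0; have v0 := t_gt0 mo; rewrite mulr_ge0//.
  by rewrite mulr_ge0 ?sqr_ge0// ltW.
by move: (t m) (t (m_opt C2 C3 n)) u0 v0 => u v u0 v0; nra.
Qed.

(** Uniqueness: the last factor of [leading_part_dist] is positive, so the square must vanish. *)
Lemma leading_part_argmin n m : (0 < n)%N -> 0 < m ->
  leading_part C1 C2 C3 m n <= leading_part C1 C2 C3 (m_opt C2 C3 n) n ->
  m = m_opt C2 C3 n.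
Proof.
move=> n0 m0 h; have mo := m_opt_gt0 n0; apply: t_inj => //.
have t0 := t_gt0 m0; have t'0 := t_gt0 mo.
have : C3 * (t m - t (m_opt C2 C3 n)) ^+ 2 *
  (t m ^+ 2 + 2 * t m * t (m_opt C2 C3 n) + 3 * t (m_opt C2 C3 n) ^+ 2) <= 0.
  by rewrite -leading_part_dist// subr_le0.
move: (t m) (t (m_opt C2 C3 n)) t0 t'0 => u v u0 v0.
rewrite pmulr_lle0; last by rewrite !addr_gt0// ?mulr_gt0// exprn_gt0.
by rewrite pmulr_rle0// real_exprn_even_le0 ?num_real//= subr_eq0 => /eqP.
Qed.

Lemma powRN_third_div n : (0 < n)%N ->
  n%:R `^ (- (1 / 3)) / n%:R = n%:R `^ (- (4 / 3)) :> R.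
Proof.
move=> n0; rewrite -(powR_inv1 (ler0n R n)) -powRD; last first.
  by apply/implyP => _; rewrite pnatr_eq0 -lt0n.
by congr (_ `^ _); field.
Qed.

(** By stationarity C3 t^4 is a quarter of n^-1 C2 t, hence the factor 3/4; the cube root in the
    statement is C2 [kappa]. *)
Lemma leading_part_m_opt n : (0 < n)%N ->
  leading_part C1 C2 C3 (m_opt C2 C3 n) n = n%:R^-1 * C1 -
  3 / 4 * n%:R `^ (- (4 / 3)) * (C2 ^+ 4 / (4 * C3)) `^ (1 / 3).
Proof.
move=> n0; have mo := m_opt_gt0 n0.
have -> : (C2 ^+ 4 / (4 * C3)) `^ (1 / 3) = C2 * kappa.
  rewrite (_ : C2 ^+ 4 / (4 * C3) = C2 ^+ 3 * (C2 / (4 * C3))); last first.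
    by field; rewrite gt_eqF.
  rewrite powRM ?exprn_ge0 ?divr_ge0 ?mulr_ge0 ?(ltW C20) ?(ltW C30)//.
  rewrite -powR_mulrn ?(ltW C20)// -powRrM.
  by rewrite (_ : 3 * (1 / 3) = 1) ?powRr1 ?(ltW C20)//; field.
rewrite /leading_part powRN2// -powRN_third_div//.
have h := t3 n0; have h' := powR_m_opt n0; rewrite -/(t _) in h' *.
rewrite (_ : _ * C2 = (n%:R^-1 * C2) * t (m_opt C2 C3 n)); last by ring.
rewrite (_ : 3 / 4 * _ * (C2 * kappa) =
    3 / 4 * ((n%:R^-1 * C2) * t (m_opt C2 C3 n))); last by rewrite h'; ring.
by rewrite h; move: (t _) (n%:R^-1) => u v; field.
Qed.

End optimum.

Lemma cvg_m_opt (R : realType) (C2 C3 : R) : 0 < C2 -> 0 < C3 ->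
  m_opt C2 C3 n @[n --> \oo] --> +oo.
Proof.
move=> C20 C30; set q := (4 * C3 / C2) `^ (2 / 3).
have q0 : 0 < q by rewrite powR_gt0// divr_gt0// mulr_gt0.
apply/cvgryPge => A.
pose B := `|A| / q.
have B0 : 0 <= B by rewrite divr_ge0// ltW.
have /cvgryPge/(_ (B `^ (3 / 2))) := @cvgr_idn R; apply: filterS => n hn.
rewrite (le_trans (ler_norm _))// /m_opt -/q -ler_pdivrMr// -/B.
have := @ge0_ler_powR R (2 / 3) _ _ _ _ _ hn.
rewrite -powRrM (_ : 3 / 2 * (2 / 3) = 1) ?powRr1//; last by field.
by apply; rewrite ?nnegrE ?powR_ge0// divr_ge0.
Qed.

Section optimal_error.
Context {R : realType}.
Variables (M : R -> nat -> \bar R) (C1 C2 C3 : R).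
Hypotheses (C20 : 0 < C2) (C30 : 0 < C3).
Hypothesis expansion : asymptotic_expansion M C1 C2 C3.

Lemma asymptotically_optimalP n m : (0 < n)%N ->
  asymptotically_optimal M C1 C2 C3 n m <-> m = m_opt C2 C3 n.
Proof.
move=> n0; split=> [[_ m0 mmin]|->].
  apply: (leading_part_argmin C20 C30 n0 m0); apply: mmin.
  exact: m_opt_gt0.
split => //; first exact: m_opt_gt0.
by move=> m' m'0; exact: leading_part_min.
Qed.

(** Along [m_opt] both error scales are multiples of n^(-4/3): m^(-1/2) n^(-1) with factor [kappa],
    and m^(-2) with factor [kappa ^+ 4]. *)
Lemma optimal_error : exists r : nat -> R,
  is_littleo \oo r (fun n : nat => n%:R `^ (- (4 / 3))) /\
  forall n : nat, (0 < n)%N -> M (m_opt C2 C3 n) n =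
    (n%:R^-1 * C1 - 3 / 4 * n%:R `^ (- (4 / 3)) *
      (C2 ^+ 4 / (4 * C3)) `^ (1 / 3) + r n)%:E.
Proof.
have [r1 [r2 [lo1 lo2 ME]]] := expansion.
pose p n := (m_opt C2 C3 n, n).
exists (fun n => r1 (p n) + r2 (p n)); split; last first.
  move=> n n0; rewrite ME ?m_opt_gt0//; congr EFin.
  by rewrite leading_part_m_opt// addrA.
set k := kappa C2 C3; have k0 : 0 < k := kappa_gt0 C20 C30.
have cp : p n @[n --> \oo] --> filter_prod (pinfty_nbhs R) \oo.
  by have := cvg_pair (cvg_m_opt C20 C30) (@cvg_id _ (nbhs \oo)); exact.
pose e1 (u : R * nat) := `|r1 u / (u.1 `^ (- (1 / 2)) * u.2%:R^-1)|.
pose e2 (u : R * nat) := `|r2 u / (u.1 `^ (- 2))|.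
have {}lo1 : e1 u @[u --> filter_prod (pinfty_nbhs R) \oo] --> 0 := lo1.
have h1 : e1 (p n) @[n --> \oo] --> 0 := cvg_comp p e1 cp lo1.
have {}lo2 : e2 u @[u --> filter_prod (pinfty_nbhs R) \oo] --> 0 := lo2.
have h2 : e2 (p n) @[n --> \oo] --> 0 := cvg_comp p e2 cp lo2.
have h : k * e1 (p n) + k ^+ 4 * e2 (p n) @[n --> \oo] --> k * 0 + k ^+ 4 * 0.
  by apply: cvgD; apply: cvgM; [exact: cvg_cst|exact: h1|exact: cvg_cst|exact: h2].
rewrite !mulr0 addr0 in h.
apply: (squeeze_cvgr _ (cvg_cst 0) h).
exists 1%N => // n /= n0; rewrite normr_ge0/=.
have n0' : 0 < n%:R :> R by rewrite ltr0n.
have x0 : 0 < n%:R `^ (- (1 / 3)) :> R by rewrite powR_gt0.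
have n4 := powRN_third_div (R := R) n0.
have xE : n%:R^-1 = (n%:R `^ (- (1 / 3))) ^+ 3 :> R.
  rewrite -powR_mulrn ?powR_ge0// -powRrM (_ : - (1 / 3) * 3 = -1); last by field.
  by rewrite powR_inv1.
rewrite mulrDl (le_trans (ler_normD _ _))// lerD//.
  rewrite -[X in X * e1 _](gtr0_norm k0) -normrM /e1 /p/= powR_m_opt// -/k -n4.
  rewrite le_eqVlt; apply/orP; left; apply/eqP; congr (`|_|); field.
  by rewrite !gt_eqF.
rewrite -[X in X * e2 _](gtr0_norm (exprn_gt0 4 k0)) -normrM /e2 /p/=.
have -> : m_opt C2 C3 n `^ (- 2) = (n%:R `^ (- (1 / 3)) * k) ^+ 4.
  rewrite -(powR_m_opt C20 C30 n0) -powR_mulrn ?powR_ge0// -powRrM.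
  by congr (_ `^ _); field.
rewrite le_eqVlt; apply/orP; left; apply/eqP; congr (`|_|).
rewrite -n4 xE; field.
by rewrite !gt_eqF.
Qed.

End optimal_error.

(** * Positivity of the constants [C2S] and [C3S] *)

Section constants.
Context {R : realType}.
Variables (f f' : R -> R) (a K0 K1 : R).
Hypothesis df : forall z : R, 0 < z -> is_derive z 1 f (f' z).
Hypothesis f'_continuous : forall z : R, 0 < z -> {for z, continuous f'}.
Hypothesis f_le : forall z : R, 0 < z -> `|f z| <= K0.
Hypothesis f'_le : forall z : R, 0 < z -> `|f' z| <= K1.
Hypothesis f_ge0 : forall x : R, 0 < x -> 0 <= f x.
Hypothesis f_integrable :
  lebesgue_measure.-integrable `]0, +oo[ (EFin \o f).
Hypothesis f_mass : (\int[lebesgue_measure]_(x in `]0%R, +oo[) (f x)%:E = 1)%E.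
Hypothesis a0 : 0 < a.

Let f_continuous (x : R) : 0 < x -> {for x, continuous f}.
Proof. by move=> x0; exact: derive_continuous (df x0). Qed.

Let weight_continuous (x : R) : {for x, continuous (fun z => expR (- (a * z)))}.
Proof.
apply: (@continuous_comp _ _ _ (fun z => - (a * z)) expR); last exact: continuous_expR.
by apply: cvgN; apply: cvgM; [exact: cvg_cst|exact: cvg_id].
Qed.

(** The mass would be c times +oo, which is -oo, 0 or +oo but never 1. *)
Lemma density_not_cst (c : R) : ~ (forall x : R, 0 < x -> f x = c).
Proof.
move=> fc; have : (\int[lebesgue_measure]_(x in `]0%R, +oo[) (f x)%:E =
    c%:E * +oo)%E.
  transitivity (\int[lebesgue_measure]_(x in `]0%R, +oo[) c%:E)%E.
    by apply: eq_integral => x /set_mem; rewrite /= in_itv/= andbT => /fc ->.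
  rewrite integral_cst//; congr (_ * _)%E.
  by apply: (etrans (lebesgue_measure_itv `]0, +oo[)); rewrite /= ltry.
rewrite f_mass; have [c0|c0|->] := ltgtP c 0.
- by rewrite lt0_muley ?lte_fin.
- by rewrite gt0_muley ?lte_fin.
- by rewrite mul0e => -[] /eqP; rewrite oner_eq0.
Qed.

(* Otherwise (f ^ 2)' = 0, so that [f] is constant and cannot have mass 1. *)
Lemma exists_derivative_neq0 : exists2 x : R, 0 < x & f x * f' x != 0.
Proof.
apply/not_exists2P => h.
have h' (x : R) : 0 < x -> f x * f' x = 0.
  by move=> x0; have [|/negP/negPn/eqP] := h x.
have d2 (z : R) : 0 < z -> is_derive z 1 (fun x => f x * f x) 0.
  move=> z0; have := is_deriveM (df z0) (df z0) => hd.
  by apply: (is_derive_eq hd); rewrite /GRing.scale/= h'// addr0.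
apply: (@density_not_cst (f 1)) => x x0.
have [c [_ _ e]] := mvt_positive (g := fun=> 0) d2 (derive_continuous (d2 _ x0))
  ltr01 (ltW x0).
have : f x ^+ 2 = f 1 ^+ 2 by rewrite !expr2; apply/eqP; rewrite -subr_eq0 e mul0r.
by move/eqP; rewrite eqrXn2 ?f_ge0// => /eqP.
Qed.

Lemma C2S_gt0 : 0 < C2S a f.
Proof.
have [x x0 fx] := exists_derivative_neq0.
have fx0 : 0 < f x.
  by rewrite lt_neqAle f_ge0// andbT eq_sym; apply: contraNneq fx => ->; rewrite mul0r.
have mVS := measurable_VS f_integrable.
rewrite /C2S (weighted_integral_ooE _ f_integrable)//.
apply: (Rintegral_gt0 (x := x)) => //.
- move=> z z0; rewrite !mulr_ge0 ?f_ge0 ?expR_ge0 ?sqrtr_ge0//.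
- apply: (integrable_weight f_ge0 f_integrable (C := K0 * (a^-1 + 1))) => // z z0.
  have [h _] := expR_sqr_le a0 z0.
  rewrite /VS normrM -mulrA ler_pM ?mulr_ge0 ?expR_ge0 ?f_le//.
  rewrite ger0_norm ?sqrtr_ge0//.
  (* The square root is at most z + 1, because z/pi <= z <= (z + 1)^2. *)
  apply: (@le_trans _ _ ((z + 1) * expR (- (a * z)))).
    rewrite ler_wpM2r ?expR_ge0//.
    have z10 : 0 <= z + 1 by rewrite addr_ge0// ltW.
    rewrite -[leRHS]ger0_norm// -sqrtr_sqr ler_sqrt ?sqr_ge0//.
    apply: (@le_trans _ _ z); last by nra.
    rewrite ler_pdivrMr ?pi_gt0// ler_peMr ?(ltW z0)//.
    by rewrite (le_trans _ (pi_ge2 R))// ler1n.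
  by rewrite mulrDl mul1r lerD// expR_weight_le1.
- apply: cvgM; [apply: cvgM; [apply: cvgM|]|].
  + exact: f_continuous.
  + apply: (@cvg_comp _ _ _ (fun z : R => z / pi) Num.sqrt _ (nbhs (x / pi))).
      by apply: cvgM; [exact: cvg_id|exact: cvg_cst].
    exact: sqrt_continuous.
  + exact: weight_continuous.
  + exact: f_continuous.
- by rewrite !mulr_gt0 ?expR_gt0// sqrtr_gt0 divr_gt0// pi_gt0.
Qed.

Lemma C3S_gt0 : 0 < C3S a f f'.
Proof.
have [x x0] := exists_derivative_neq0; rewrite mulf_eq0 negb_or => /andP[fx f'x].
have fx0 : 0 < f x by rewrite lt_neqAle f_ge0// eq_sym fx.
have mbS := measurable_bS2 f'_continuous.
rewrite /C3S (weighted_integral_ooE _ f_integrable)//.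
apply: (Rintegral_gt0 (x := x)) => //.
- by move=> z z0; rewrite mulr_ge0 ?f_ge0// mulr_ge0 ?expR_ge0// sqr_ge0.
- apply: (integrable_weight f_ge0 f_integrable
    (C := K1 ^+ 2 / 4 * (4 / a ^+ 2))) => // z z0.
  have [_ h] := expR_sqr_le a0 z0.
  rewrite ger0_norm ?sqr_ge0// /bS.
  apply: (@le_trans _ _ (K1 ^+ 2 / 4 * (z ^+ 2 * expR (- (a * z))))).
    rewrite [leLHS](_ : _ = f' z ^+ 2 / 4 * (z ^+ 2 * expR (- (a * z)))); last first.
      by field.
    have hz : f' z ^+ 2 <= K1 ^+ 2.
      rewrite -real_normK ?num_real// lerXn2r ?nnegrE ?f'_le//.
      by rewrite (le_trans _ (f'_le z0)).
    apply: ler_wpM2r; first by rewrite mulr_ge0 ?sqr_ge0 ?expR_ge0.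
    exact: ler_wpM2r.
  by rewrite ler_wpM2l// divr_ge0// sqr_ge0.
- have cb : {for x, continuous (bS f')}.
    apply: cvgM; last exact: cvg_cst.
    by apply: cvgM; [exact: cvg_id|exact: f'_continuous].
  apply: cvgM; [apply: cvgM|]; last exact: f_continuous.
    by under eq_cvg do rewrite expr2; rewrite expr2; exact: cvgM.
  exact: weight_continuous.
- rewrite mulr_gt0// mulr_gt0 ?expR_gt0// exprn_even_gt0//= /bS.
  by rewrite !mulf_neq0 ?(gt_eqF x0)// invr_eq0.
Qed.

End constants.

(** * From the hypotheses on the closed half-line to the theorem *)

Lemma cdf_nondecreasing_fun (R : realType) (d : measure_display)
    (T : measurableType d) (P : probability T R) (X : {RV P >-> R}) (F : R -> R) :
  (forall x, cdf X x = (F x)%:E) -> {homo F : x y / x <= y}.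
Proof. by move=> h x y xy; rewrite -lee_fin -!h cdf_nondecreasing. Qed.

Theorem corollary3 (R : realType) (d : measure_display)
    (T : measurableType d) (P : probability T R)
    (X : nat -> {RV P >-> R}) (F f f' : R -> R) (a : R)
    (X_ge0 : forall (i : nat) (w : T), 0 <= X i w)
    (X_indep : mutually_independent X)
    (X_ident : identically_distributed X)
    (F_cdf : forall (i : nat) (x : R), cdf (X i) x = (F x)%:E)
    (F0 : F 0 = 0)
    (f_density : forall i : nat, has_density (X i) f)
    (F_cont : continuous F)
    (F_deriv : derivative_on `[0, +oo[ F f)
    (f_deriv : derivative_on `[0, +oo[ f f')
    (f_cont : {within `[0, +oo[, continuous f})
    (f'_cont : {within `[0, +oo[, continuous f'})
    (f_bounded : [bounded f x | x in `[0, +oo[])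
    (f'_bounded : [bounded f' x | x in `[0, +oo[])
    (a_gt0 : 0 < a) :
  let C1 := C1S a F f in
  let C2 := C2S a f in
  let C3 := C3S a f f' in
  (forall (n : nat) (m : R), (0 < n)%N ->
     asymptotically_optimal (MISE X F f a) C1 C2 C3 n m <->
     m = m_opt C2 C3 n) /\
  (exists r : nat -> R,
     is_littleo \oo r (fun n : nat => n%:R `^ (- (4 / 3))) /\
     forall n : nat, (0 < n)%N ->
       MISE X F f a (m_opt C2 C3 n) n =
       (n%:R^-1 * C1
        - 3 / 4 * n%:R `^ (- (4 / 3)) * (C2 ^+ 4 / (4 * C3)) `^ (1 / 3)
        + r n)%:E).
Proof.
have pos_nbhs (z : R) : 0 < z -> nbhs z `[0, +oo[%classic.
  move=> z0; have oD := @interval_open R (BRight 0) +oo%O isT isT.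
  apply: filterS (open_nbhs_nbhs (conj oD _)).
    by move=> y /=; rewrite !in_itv/= !andbT; exact: ltW.
  by rewrite /= in_itv/= z0.
have pos_in (z : R) : 0 < z -> `[0, +oo[%classic z.
  by move=> z0; rewrite /= in_itv/= andbT ltW.
have dF (z : R) : 0 < z -> is_derive z 1 F (f z).
  by move=> z0; exact: is_derive_derivative_on F_deriv (pos_nbhs _ z0).
have df (z : R) : 0 < z -> is_derive z 1 f (f' z).
  by move=> z0; exact: is_derive_derivative_on f_deriv (pos_nbhs _ z0).
have f'c (z : R) : 0 < z -> {for z, continuous f'}.
  move=> z0; have oD : open (`]0, +oo[%classic : set R) by exact: interval_open.
  have : {within `]0, +oo[%classic, continuous f'}.
    apply: continuous_subspaceW f'_cont => y /=.
    by rewrite !in_itv/= !andbT; exact: ltW.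
  by rewrite continuous_open_subspace//; apply; rewrite inE/= in_itv/= z0.
have [K0 hK0] := bounded_on_le f_bounded.
have [K1 hK1] := bounded_on_le f'_bounded.
have f_le (z : R) : 0 < z -> `|f z| <= K0 by move=> /pos_in/hK0.
have f'_le (z : R) : 0 < z -> `|f' z| <= K1 by move=> /pos_in/hK1.
(* A density is determined only almost everywhere; the sign at every point comes from the
   monotonicity of [F]. *)
have f_ge0 (z : R) : 0 < z -> 0 <= f z.
  by move=> /dF; apply: is_derive_nondecreasing_ge0 (cdf_nondecreasing_fun (F_cdf 0)).
have mf : measurable_fun (`]0, +oo[ : set R) f.
  apply: open_continuous_measurable_fun; first exact: interval_open.
  move=> x; rewrite inE/= in_itv/= andbT => x0.
  exact: derive_continuous (df _ x0).
have f_mass : (\int[lebesgue_measure]_(x in `]0%R, +oo[) (f x)%:E = 1)%E.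
  rewrite integral_itv_obnd_cbnd; last exact/measurable_EFinP.
  rewrite -[in LHS](setTI `[0%R, +oo[%classic) -(f_density 0)//.
  exact: probability_setT.
have f_int : lebesgue_measure.-integrable `]0, +oo[ (EFin \o f).
  apply/integrableP; split; first exact/measurable_EFinP.
  rewrite [ltLHS](_ : _ = 1%E) ?ltry// -[RHS]f_mass.
  apply: eq_integral => x /set_mem; rewrite /= in_itv/= andbT => /f_ge0 fx.
  by rewrite ger0_norm.
move=> C1 C2 C3.
have C20 : 0 < C2 by exact: (C2S_gt0 df f_le f_ge0 f_int f_mass a_gt0).
have C30 : 0 < C3 by exact: (C3S_gt0 df f'c f'_le f_ge0 f_int f_mass a_gt0).
have expansion : asymptotic_expansion (MISE X F f a) C1 C2 C3.
  exact: (MISE_asymptotic_expansion X_indep F_cdf F_cont dF df f'c f_le f'_le).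
split; last exact: optimal_error.
by move=> n m n0; exact: asymptotically_optimalP.
Qed.
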